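(* Let $g=3$ and let $v\in\operatorname{gr}_2A$ be such that $H^3=W^3\oplus\mathbb{C}\,v\,dz^3$. Then for every $n\ge2$ the following elements form a $\mathbb{C}$-linear basis of $\operatorname{gr}_nA$ (all exponents are non-negative integers, and a family is empty if the required sum of its exponents is negative): $$\partial_1^{i_1}\partial_2^{i_2}\partial_3^{i_3}\log\theta\quad(i_1+i_2+i_3=n),\qquad \partial_1^{i_1}\partial_2^{i_2}\partial_3^{i_3}v\quad(i_1+i_2+i_3=n-2),$$ $$\partial_1^{i_1}\partial_2^{i_2}(12;12),\quad \partial_1^{i_1}\partial_2^{i_2}(12;13),\quad \partial_1^{i_1}\partial_2^{i_2}(12;23)\quad(i_1+i_2=n-3),$$ $$\partial_1^{i_1}\partial_2^{i_2}\partial_3^{i_3}(13;13),\quad \partial_1^{i_1}\partial_2^{i_2}\partial_3^{i_3}(13;23),\quad \partial_1^{i_1}\partial_2^{i_2}\partial_3^{i_3}(23;23)\quad(i_1+i_2+i_3=n-3),$$ $$\partial_1^{i_1}\partial_2^{i_2}\partial_3^{i_3}(123;123)\quad(i_1+i_2+i_3=n-4).$$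
   Context: Let $\tau$ be a symmetric $3\times3$ complex matrix with positive definite imaginary part, $J=\mathbb{C}^3/(\mathbb{Z}^3+\tau\mathbb{Z}^3)$, $\theta(z)=\sum_{n\in\mathbb{Z}^3}\exp(\pi i\,{}^tn\tau n+2\pi i\,{}^tnz)$, $z=(z_1,z_2,z_3)$, $\Theta=(\theta(z)=0)\subset J$. Assume $\Theta$ is non-singular. $A_n$ ($n\ge0$) is the space of meromorphic functions on $J$ with poles only on $\Theta$, of order at most $n$; $A_n=0$ for $n<0$; $\operatorname{gr}_nA=A_n/A_{n-1}$, $\operatorname{gr}A=\bigoplus_{n\ge 0}\operatorname{gr}_nA$. $\partial_i=\partial/\partial z_i$ maps $A_n$ to $A_{n+1}$ and hence $\operatorname{gr}_nA$ to $\operatorname{gr}_{n+1}A$. Put $\zeta_{ij}=\partial_i\partial_j\log\theta\in A_2$, and for $I=(i_1,\dots,i_r)$, $J'=(j_1,\dots,j_r)$ put $(I;J')=\det(\zeta_{i_kj_l})_{1\le k,l\le r}$, which lies in $A_{r+1}$ and is regarded as an element of $\operatorname{gr}_{r+1}A$; e.g. $(12;13)=\zeta_{11}\zeta_{23}-\zeta_{13}\zeta_{21}$. Let $T^*=\bigoplus_{i=1}^3\mathbb{C}\,dz_i$, $dz^3=dz_1\wedge dz_2\wedge dz_3$, and $H^3=\operatorname{gr}A\,dz^3/d(\operatorname{gr}A\otimes\wedge^2T^* )$ with $d=\sum_i\partial_i\otimes dz_i$, the highest cohomology group of the complex $(\operatorname{gr}A\otimes\wedge^\bullet T^*,d)$.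 Here $W^3\subset H^3$ denotes the subspace spanned by the classes of $dz^3$, $\zeta_{ij}dz^3$, $(ij;kl)dz^3$ and $(123;123)dz^3$; it has codimension one in $H^3$, with complement spanned by the class of $v\,dz^3$ for some $v\in\operatorname{gr}_2A$. *)

(* Defs.v *)
From HB Require Import structures.
From mathcomp Require Import all_boot all_order all_algebra.
From mathcomp Require Import finmap complex.
From mathcomp Require Import all_classical all_reals all_analysis.
From mathcomp.analysis.showcase Require Import summability.
Set Implicit Arguments.
Unset Strict Implicit.
Unset Printing Implicit Defensive.
Import Order.TTheory GRing.Theory Num.Theory numFieldNormedType.Exports.
Local Open Scope classical_set_scope.
Local Open Scope ring_scope.
Local Open Scope complex_scope.

(* Quotients E / B of subspaces B <= E of an ambient space V are not formed as
   types: a class is given by a representative in E. *)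
Section Quotients.
Variables (K : nzRingType) (V : lmodType K).

Definition linear_span (S : set V) : set V :=
  [set x | exists (m : nat) (c : 'I_m -> K) (s : 'I_m -> V),
     (forall k, S (s k)) /\ x = \sum_(k < m) c k *: s k].

(* The classes of the members of s (with multiplicity) are a basis of E / B. *)
Definition quotient_basis (E B : set V) (s : seq V) : Prop :=
  [/\ forall k, (k < size s)%N -> E s`_k,
      forall c : nat -> K, B (\sum_(k < size s) c k *: s`_k) ->
        forall k, (k < size s)%N -> c k = 0
    & forall x, E x ->
        exists c : nat -> K, B (x - \sum_(k < size s) c k *: s`_k)].

(* For subspaces W, U of E: E / B is the internal direct sum of their images. *)
Definition quotient_direct_sum (E B W U : set V) : Prop :=
  (forall x, E x -> exists w u, [/\ W w, U u & B (x - (w + u))]) /\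
  (forall w u, W w -> U u -> B (w - u) -> B w).

End Quotients.

(* The carrier is R[i]; naming the structure lets the topology and norm that
   exist on every numeric closed field be inferred for it. With C R as scalar
   field, [differentiable] is complex (Frechet) differentiability and 'D_v is
   the complex derivative in the direction v. *)
Definition C (R : realType) : numClosedFieldType := R[i].

Definition cexp (R : realType) (z : C R) : C R :=
  let: x +i* y := z in (expR x * cos y) +i* (expR x * sin y).

Section Theta.
Variables (R : realType) (tau : 'M[C R]_3).

Local Notation fn := ('cV[C R]_3 -> C R).

Definition intv (n : 'cV[int]_3) : 'cV[C R]_3 := map_mx intr n.

Definition siegel : Prop :=
  tau^T = tau /\
  forall x : 'cV[R]_3, x != 0 ->
    0 < (x^T *m map_mx (fun w : C R => complex.Im w) tau *m x) 0 0.

(* [sum] is unordered summation. *)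
Definition theta : fn := fun z =>
  sum (fun n : 'cV[int]_3 =>
    let piI : C R := 0 +i* pi in
    cexp (piI * ((intv n)^T *m tau *m intv n) 0 0
          + 2 * piI * ((intv n)^T *m z) 0 0)).

Definition partial (i : 'I_3) (f : fn) : fn := fun z => 'D_(delta_mx i 0) f z.

Definition theta_nonsingular : Prop :=
  forall z, theta z = 0 -> exists i, partial i theta z <> 0.

Definition entire (F : fn) : Prop := forall z, differentiable F z.

(* A meromorphic function on J with poles only on Theta is represented by a
   function on C^3 of which only the values off Theta = (theta = 0) matter;
   hence the zero space is the set of functions vanishing off Theta, and it is
   contained in every A n. As theta is a local equation of the non-singular
   divisor Theta, a pole of order at most n means that f * theta ^ n extends
   holomorphically across Theta. *)
Definition A (n : int) : set fn :=
  match n with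
  | Posz m => [set f |
      (forall (a b : 'cV[int]_3) z, theta z != 0 ->
         f (z + intv a + tau *m intv b) = f z) /\
      exists2 F, entire F &
        forall z, theta z != 0 -> f z * theta z ^+ m = F z]
  | Negz _ => [set f | forall z, theta z != 0 -> f z = 0]
  end.

Definition dlogtheta (j : 'I_3) : fn := fun z => partial j theta z / theta z.

Definition zeta (i j : 'I_3) : fn := partial i (dlogtheta j).

(* (I; J') *)
Definition zminor (r : nat) (I J' : r.-tuple 'I_3) : fn := fun z =>
  \det (\matrix_(k < r, l < r) zeta (tnth I k) (tnth J' l) z).

(* The indices 1, 2, 3. *)
Definition i1 : 'I_3 := @Ordinal 3 0 isT.
Definition i2 : 'I_3 := @Ordinal 3 1 isT.
Definition i3 : 'I_3 := @Ordinal 3 2 isT.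

Definition partials (m : nat * nat * nat) (f : fn) : fn :=
  iter m.1.1 (partial i1) (iter m.1.2 (partial i2) (iter m.2 (partial i3) f)).

(* The innermost derivation is the logarithmic derivative, so that no branch
   of log theta is needed; the value at (0, 0, 0) is irrelevant. *)
Definition partials_logtheta (m : nat * nat * nat) : fn :=
  match m with
  | (a, b, c.+1) => partials (a, b, c) (dlogtheta i3)
  | (a, b.+1, 0%N) => partials (a, b, 0%N) (dlogtheta i2)
  | (a.+1, 0%N, 0%N) => partials (a, 0%N, 0%N) (dlogtheta i1)
  | (0%N, 0%N, 0%N) => 0
  end.

(* Elements of gr A are represented by sequences a with a n in A n, almost all
   of whose terms are zero in A n / A (n - 1); grA0 is the zero element. *)
Definition grA : set (nat -> fn) :=
  [set a | (forall n : nat, A n%:Z (a n)) /\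
     exists N : nat, forall n : nat, (N <= n)%N -> A (n%:Z - 1) (a n)].

Definition grA0 : set (nat -> fn) :=
  [set a | forall n : nat, A (n%:Z - 1) (a n)].

Definition homog (n : nat) (f : fn) : nat -> fn :=
  fun m => if m == n then f else 0.

Definition gpartial (i : 'I_3) (a : nat -> fn) : nat -> fn :=
  fun n => if n is m.+1 then partial i (a m) else 0.

(* 3-forms a dz^3 are identified with their coefficient a. This is d of the
   2-form a12 dz_1^dz_2 + a13 dz_1^dz_3 + a23 dz_2^dz_3. *)
Definition d2 (a12 a13 a23 : nat -> fn) : nat -> fn :=
  gpartial i1 a23 - gpartial i2 a13 + gpartial i3 a12.

(* H^3 is grA / B3. *)
Definition B3 : set (nat -> fn) :=
  [set b | exists a12 a13 a23,
     [/\ grA a12, grA a13, grA a23 & grA0 (b - d2 a12 a13 a23)]].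

Definition W3 : set (nat -> fn) :=
  linear_span (
    [set homog 0 (fun=> 1)]
    `|` [set a | exists i j, a = homog 2 (zeta i j)]
    `|` [set a | exists i j k l, a = homog 3 (zminor [tuple i; j] [tuple k; l])]
    `|` [set homog 4 (zminor [tuple i1; i2; i3] [tuple i1; i2; i3])]).

(* H^3 = W^3 + C v dz^3, a direct sum. *)
Definition complements_W3 (v : fn) : Prop :=
  quotient_direct_sum grA B3 W3 (linear_span [set homog 2 v]).

(* s represents a basis of gr_n A = A_n / A_(n - 1). *)
Definition gr_basis (n : nat) (s : seq fn) : Prop :=
  quotient_basis (A n%:Z) (A (n%:Z - 1)) s.

(* All exponents of sum n - k; none if n < k. *)
Definition exps3 (n k : nat) : seq (nat * nat * nat) :=
  [seq m <- [seq (p, c) | p <- [seq (a, b) | a <- iota 0 n.+1, b <- iota 0 n.+1],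
                          c <- iota 0 n.+1]
  | (m.1.1 + m.1.2 + m.2 + k == n)%N].

Definition exps2 (n k : nat) : seq (nat * nat * nat) :=
  [seq m <- exps3 n k | m.2 == 0%N].

Definition gr_family (v : fn) (n : nat) : seq fn :=
  [seq partials_logtheta m | m <- exps3 n 0]
  ++ [seq partials m v | m <- exps3 n 2]
  ++ [seq partials m (zminor [tuple i1; i2] [tuple i1; i2]) | m <- exps2 n 3]
  ++ [seq partials m (zminor [tuple i1; i2] [tuple i1; i3]) | m <- exps2 n 3]
  ++ [seq partials m (zminor [tuple i1; i2] [tuple i2; i3]) | m <- exps2 n 3]
  ++ [seq partials m (zminor [tuple i1; i3] [tuple i1; i3]) | m <- exps3 n 3]
  ++ [seq partials m (zminor [tuple i1; i3] [tuple i2; i3]) | m <- exps3 n 3]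
  ++ [seq partials m (zminor [tuple i2; i3] [tuple i2; i3]) | m <- exps3 n 3]
  ++ [seq partials m (zminor [tuple i1; i2; i3] [tuple i1; i2; i3])
     | m <- exps3 n 4].

End Theta.

(* Main.v *)
From HB Require Import structures.
Require Import Defs.
From mathcomp Require Import all_boot all_order all_algebra.
From mathcomp Require Import finmap complex ring lra zify.
From mathcomp Require Import all_classical all_reals all_analysis.
From mathcomp.analysis.showcase Require Import summability.
Set Implicit Arguments.
Unset Strict Implicit.
Unset Printing Implicit Defensive.
Import Order.TTheory GRing.Theory Num.Theory numFieldNormedType.Exports.
Local Open Scope classical_set_scope.
Local Open Scope ring_scope.
Local Open Scope complex_scope.

(** The decomposition of H^3 says that gr A is generated, as a module over
    C[d_1, d_2, d_3], by 1, the zeta_ij, v, the 2x2 minors and the 3x3 minor. The closed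
    2-forms d(d_k log theta) /\ d(d_l log theta) give the relations that eliminate d_3
    from the three minors (12;12), (12;13), (12;23), and A_0, A_1 come out as the
    constants. So 1 and the proposed families of degrees 2, ..., n span A_n, and there
    are n^3 of them. On the other hand A_n contains the n^3 functions
    theta_chi / theta^n, where theta_chi is the part of the theta series of tau / n
    supported on a residue class chi modulo n; these are independent because Fourier
    coefficients are unique. Hence all families are independent.

    No Cauchy theory is needed: for n = 2 the comparison writes v as a combination of
    theta_chi / theta^2, so only explicit Fourier series and their derivatives occur. *)

(** The obstacle is differentiation. [entire] asks only for complex differentiability at every
    point, so without Cauchy's theorem it is unclear that a derivation maps [A n] to [A (n + 1)], or
    that iterated derivatives of v make sense or commute. All calculus therefore takes place in
    [entire_ring], the functions built from Fourier series and constants by sums and products, and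
    [pole_le n] is [A n] with the numerator taken from that ring. Elements of an abstract [A n]
    enter this class only afterwards, as combinations of generators. This is not circular: the
    spanning argument in degree n differentiates only generators of degree below n, and those of
    degree 0 and 1 reduce to the constant 1. So degree 2 is reached without ever differentiating v,
    and there v receives an explicit numerator. The count n^3 is the telescoping sum of d^3 -
    (d-1)^3 = 3d^2 - 3d + 1, the size of the family of degree d >= 2, plus 1 for the constants. Only
    upper bounds on these sizes enter: n^3 independent functions in the span of at most n^3 force
    equality. *)

(** * The real-valued modulus of a complex number *)

Section ComplexModulus.
Variable R : realType.
Implicit Types z w : C R.

(** The norm of [C R] takes its values in [C R] itself; a modulus in [R] makes real analysis and
    [lra] available for the estimates. *)
Definition cmod (z : C R) : R := ComplexField.Normc.normc z.

Lemma normrE_cmod z : `|z| = (cmod z)%:C. Proof. by []. Qed.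

Lemma cmodM z w : cmod (z * w) = cmod z * cmod w.
Proof. exact: ComplexField.Normc.normcM. Qed.

Lemma cmodN z : cmod (- z) = cmod z.
Proof. by apply: (@complexI R); rewrite -!normrE_cmod normrN. Qed.

Lemma cmodD z w : cmod (z + w) <= cmod z + cmod w.
Proof. by rewrite -lecR rmorphD /= -!normrE_cmod; exact: ler_normD. Qed.

Lemma cmodB z w : cmod (z - w) <= cmod z + cmod w.
Proof. by rewrite -(cmodN w); exact: cmodD. Qed.

Lemma cmod_ge0 z : 0 <= cmod z.
Proof. by rewrite -lecR -normrE_cmod; exact: normr_ge0. Qed.

Lemma cmod0 : cmod 0 = 0.
Proof. by apply: (@complexI R); rewrite -normrE_cmod normr0. Qed.

Lemma cmod_eq0 z : cmod z = 0 -> z = 0.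
Proof. by move=> h; apply/eqP; rewrite -normr_eq0 normrE_cmod h. Qed.

Lemma cmod_real (x : R) : cmod x%:C = `|x|.
Proof. by rewrite /cmod /= expr0n /= addr0 sqrtr_sqr. Qed.

Lemma cmod_sum (I : Type) (r : seq I) (P : pred I) (f : I -> C R) :
  cmod (\sum_(i <- r | P i) f i) <= \sum_(i <- r | P i) cmod (f i).
Proof.
elim/big_ind2: _ => [|x1 x2 y1 y2 h1 h2|//]; first by rewrite cmod0.
exact: le_trans (cmodD _ _) (lerD h1 h2).
Qed.

Lemma cmod_ge_Re z : `|complex.Re z| <= cmod z.
Proof. by rewrite -lecR -normrE_cmod; exact: normc_ge_Re. Qed.

Lemma cmod_ge_Im z : `|complex.Im z| <= cmod z.
Proof.
case: z => a b /=; rewrite /cmod /= -[X in X <= _]sqrtr_sqr ler_wsqrtr //.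
by rewrite lerDr sqr_ge0.
Qed.

End ComplexModulus.
Arguments cmod {R} z : simpl never.

(** * Unordered summation of complex families *)

Section UnorderedSums.
Variables (R : realType) (I : choiceType).
Implicit Types (f g : I -> C R) (s t : C R).

(** A relation rather than the value [sum f], which is a limit and says nothing unless the limit
    exists; convergence and value travel together here. *)
Definition has_sum f s := forall e : R, 0 < e -> exists J : {fset I},
  forall K : {fset I}, (J `<=` K)%fset -> cmod (\sum_(i <- K) f i - s) < e.

Definition abs_sum_le f (B : R) :=
  forall K : {fset I}, \sum_(i <- K) cmod (f i) <= B.

Lemma has_sumD f g s t :
  has_sum f s -> has_sum g t -> has_sum (fun i => f i + g i) (s + t).
Proof.
move=> hf hg e e0; have e2 : 0 < e / 2 by rewrite divr_gt0.
have [J hJ] := hf _ e2; have [L hL] := hg _ e2.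
exists (J `|` L)%fset => K; rewrite fsubUset => /andP[JK LK].
rewrite big_split /= opprD addrACA; apply: le_lt_trans (cmodD _ _) _.
by rewrite [e]splitr ltrD ?hJ ?hL.
Qed.

Lemma has_sum0 : has_sum (fun=> 0) 0.
Proof. by move=> e e0; exists fset0 => K _; rewrite big1 // subr0 cmod0. Qed.

Lemma has_sumZ c f s : has_sum f s -> has_sum (fun i => c * f i) (c * s).
Proof.
move=> hf e e0; have c1 : 0 < cmod c + 1 by have := cmod_ge0 c; lra.
have [J hJ] := hf _ (divr_gt0 e0 c1).
exists J => K /hJ h; rewrite -mulr_sumr -mulrBr cmodM.
apply: (@le_lt_trans _ _ ((cmod c + 1) * cmod (\sum_(i <- K) f i - s))).
  by rewrite ler_wpM2r ?cmod_ge0 // lerDl.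
by rewrite mulrC -ltr_pdivlMr.
Qed.

Lemma has_sum_sum (T : Type) (r : seq T) (f : T -> I -> C R) (s : T -> C R) :
  (forall j, has_sum (f j) (s j)) ->
  has_sum (fun i => \sum_(j <- r) f j i) (\sum_(j <- r) s j).
Proof.
move=> h; elim: r => [|j r IH].
  rewrite big_nil (_ : (fun _ => _) = fun=> 0); first exact: has_sum0.
  by apply: funext => i; rewrite big_nil.
rewrite big_cons (_ : (fun _ => _) = fun i => f j i + \sum_(j <- r) f j i).
  exact: has_sumD.
by apply: funext => i; rewrite big_cons.
Qed.

Lemma has_sum_unique f s t : has_sum f s -> has_sum f t -> s = t.
Proof.
move=> hs ht; apply/eqP; rewrite -subr_eq0; apply/eqP/cmod_eq0/eqP.
rewrite eq_le cmod_ge0 andbT; apply/ler_addgt0Pr => e e0; rewrite add0r.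
have e2 : 0 < e / 2 by rewrite divr_gt0.
have [J hJ] := hs _ e2; have [L hL] := ht _ e2.
have /hJ h1 : (J `<=` J `|` L)%fset by exact: fsubsetUl.
have /hL h2 : (L `<=` J `|` L)%fset by exact: fsubsetUr.
set S := \sum_(i <- _) _ in h1 h2.
rewrite (_ : s - t = (S - t) - (S - s)); last by ring.
by apply: le_trans (cmodB _ _) _; rewrite [e]splitr ltW // ltrD.
Qed.

Lemma has_sum_reindex (sg sg' : I -> I) f s : cancel sg sg' -> cancel sg' sg ->
  has_sum f s -> has_sum (f \o sg) s.
Proof.
move=> K1 K2 hf e e0; have [J hJ] := hf _ e0.
exists [fset sg' i | i in J]%fset => K sK.
have /hJ : (J `<=` [fset sg i | i in K])%fset.
  apply/fsubsetP => i iJ; rewrite -(K2 i); apply: in_imfset.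
  by apply: (fsubsetP sK); apply: in_imfset.
by rewrite big_imfset // => x y _ _ /(can_inj K1).
Qed.

Lemma has_sum_le f s B : has_sum f s -> abs_sum_le f B -> cmod s <= B.
Proof.
move=> hf hB; apply/ler_addgt0Pr => e e0; have [J hJ] := hf _ e0.
have h := hJ J (fsubset_refl _); set S := \sum_(i <- J) f i in h.
rewrite (_ : s = S - (S - s)); last by ring.
apply: le_trans (cmodB _ _) _; apply: lerD; last exact: ltW.
exact: le_trans (cmod_sum _ _ _) (hB J).
Qed.

(** The sum is the supremum of the finite partial sums, which increase with the index set. *)
Lemma nonneg_has_sum (g : I -> R) (B : R) : (forall i, 0 <= g i) ->
  (forall K : {fset I}, \sum_(i <- K) g i <= B) ->
  exists s : C R, has_sum (fun i => (g i)%:C) s.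
Proof.
move=> g0 hB; pose E : set R := [set \sum_(i <- K) g i | K in [set: {fset I}]].
have supE : has_sup E.
  split; first by exists (\sum_(i <- fset0) g i), fset0.
  by exists B => _ [K _ <-].
exists (sup E)%:C => e e0.
have [_ [J _ <-] hJ] := sup_adherent e0 supE; exists J => K JK.
have le1 : \sum_(i <- J) g i <= \sum_(i <- K) g i.
  rewrite [X in _ <= X](big_fsetID _ (mem J)) /=.
  rewrite (_ : [fset x | x in K & x \in J]%fset = J).
    by rewrite lerDl; apply: sumr_ge0.
  apply/fsetP => i; rewrite !inE /= andbC.
  by case: (boolP (i \in J)) => //= /(fsubsetP JK) ->.
have le2 : \sum_(i <- K) g i <= sup E by apply: ub_le_sup; [case: supE | exists K].
rewrite -rmorph_sum -rmorphB cmod_real ltr_norml; lra.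
Qed.

(** Real and imaginary parts are each split into positive and negative parts; the four non-negative
    families obtained are dominated by [cmod (f i)]. *)
Lemma abs_has_sum f B : abs_sum_le f B -> exists s, has_sum f s.
Proof.
move=> hB; pose pos (x : R) := (`|x| + x) / 2.
have pos0 x : 0 <= pos x.
  by rewrite /pos divr_ge0 //; have := ler_norm (- x); rewrite normrN; lra.
have posle x : pos x <= `|x| by rewrite /pos; have := ler_norm x; lra.
have posB x : pos x - pos (- x) = x by rewrite /pos normrN; field.
have ex (h : C R -> R) : (forall z, `|h z| <= cmod z) ->
    exists s, has_sum (fun i => (h (f i))%:C) s.
  move=> hle.
  have aux (k : R -> R) : (forall x, `|k x| = `|x|) ->
      exists s, has_sum (fun i => (pos (k (h (f i))))%:C) s.
    move=> hk; apply: (@nonneg_has_sum _ B) => // K; apply: le_trans (hB K).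
    apply: ler_sum => i _; apply: le_trans (posle _) _.
    by rewrite hk.
  have [s hs] := aux id (fun=> erefl); have [t ht] := aux -%R (@normrN _ _).
  exists (s + (-1) * t); move: (has_sumD hs (has_sumZ (-1) ht)).
  congr has_sum; apply: funext => i /=.
  by rewrite mulN1r -rmorphN -rmorphD posB.
have [s hs] := ex _ (@cmod_ge_Re R); have [t ht] := ex _ (@cmod_ge_Im R).
exists (s + 'i * t); move: (has_sumD hs (has_sumZ 'i ht)).
by congr has_sum; apply: funext => i /=; rewrite -complexE.
Qed.

Lemma has_sumE f s : has_sum f s -> sum f = s.
Proof.
move=> hf; have FF := @totally_filter I; apply: cvg_lim; first exact: norm_hausdorff.
(* The tolerance is an element of [C R]; being positive it is real, and its real part is the
   tolerance handed to [has_sum]. *)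
apply/cvgrPdist_lt => e e0; have e_real : e \is Num.real by rewrite gtr0_real.
rewrite -(RRe_real e_real) in e0 *; rewrite ltcR in e0.
have [J hJ] := hf _ e0; exists J => // K /= JK.
rewrite /partial_sum -(big_seq_fsetE _ K xpredT f) distrC normrE_cmod ltcR.
exact: hJ.
Qed.

Lemma abs_sumE f B : abs_sum_le f B -> has_sum f (sum f).
Proof. by move=> /abs_has_sum[s hs]; rewrite (has_sumE hs). Qed.

End UnorderedSums.

(** * The complex exponential and its second-order remainder *)

Section ComplexExp.
Variable R : realType.
Implicit Types z w : C R.

Lemma cexpD z w : cexp (z + w) = cexp z * cexp w :> C R.
Proof.
case: z w => [a b] [c d]; rewrite /cexp /=; apply/eqP; rewrite eq_complex /=.
by rewrite expRD cosD sinD; apply/andP; split; apply/eqP; ring.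
Qed.

Lemma cexp0 : cexp 0 = 1 :> C R.
Proof. by rewrite /cexp /= expR0 cos0 sin0 mulr1 mulr0. Qed.

Lemma cmod_cexp z : cmod (cexp z) = expR (complex.Re z).
Proof.
case: z => a b; rewrite /cexp /cmod /= !exprMn -mulrDr cos2Dsin2 mulr1.
by rewrite sqrtr_sqr ger0_norm ?expR_ge0.
Qed.

Lemma cexp_neq0 z : cexp z != 0 :> C R.
Proof.
by apply/eqP => /(congr1 (@cmod R)); rewrite cmod_cexp cmod0 => /eqP; rewrite expR_eq0.
Qed.

Lemma cexpN z : cexp (- z) = (cexp z)^-1 :> C R.
Proof. by apply: (mulIf (cexp_neq0 z)); rewrite -cexpD addNr cexp0 mulVf ?cexp_neq0. Qed.

Lemma cexpMn z n : cexp (z *+ n) = cexp z ^+ n :> C R.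
Proof.
elim: n => [|n IH]; first by rewrite mulr0n cexp0 expr0.
by rewrite mulrS cexpD IH exprS.
Qed.

Lemma cexpMz z (k : int) : cexp (z *~ k) = cexp z ^ k :> C R.
Proof.
case: k => n; first by rewrite -!pmulrn cexpMn.
by rewrite NegzE mulrNz cexpN -pmulrn cexpMn -exprnN.
Qed.

Lemma cmod_cexp_le z : cmod (cexp z) <= expR (cmod z).
Proof.
by rewrite cmod_cexp ler_expR; apply: le_trans (cmod_ge_Re z); exact: ler_norm.
Qed.

Lemma expR_sub1_bound (x : R) : `|expR x - 1| <= `|x| * expR `|x|.
Proof.
have h1 := expR_ge1Dx x; have h2 := expR_ge1Dx (- x); have h0 := expR_gt0 x.
have h3 : expR x * expR (- x) = 1 by rewrite expRxMexpNx_1.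
have [x0|x0] := ger0P x; first by rewrite ger0_norm; nra.
have := expR_ge1Dx (- x); have : expR x < 1 by rewrite expR_lt1.
by move=> *; rewrite ltr0_norm; nra.
Qed.

(** Everything follows from 1 + x <= exp x at x and at -x, together with exp x * exp (-x) = 1. *)
Lemma expR_taylor1 (x : R) : `|expR x - 1 - x| <= x ^+ 2 * expR `|x|.
Proof.
have h1 := expR_ge1Dx x; have h2 := expR_ge1Dx (- x); have h0 := expR_gt0 x.
have h3 : expR x * expR (- x) = 1 by rewrite expRxMexpNx_1.
rewrite ger0_norm; last lra.
have h4 : expR x - 1 <= x * expR x by nra.
have [x0|x0] := ger0P x.
  apply: (@le_trans _ _ (x * (expR x - 1))); first nra.
  by rewrite expr2 -mulrA ler_wpM2l.
apply: (@le_trans _ _ (x ^+ 2)); first nra.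
by rewrite ler_peMr ?sqr_ge0 //; nra.
Qed.

(** The half-angle formula 1 - cos y = 2 sin^2 (y/2) reduces this to |sin x| <= |x|, a case of the
    mean value theorem. *)
Lemma cos_sub1_bound (y : R) : `|cos y - 1| <= y ^+ 2.
Proof.
have sinle (x : R) : `|sin x| <= `|x|.
  have aux (t : R) : 0 <= t -> `|sin t| <= t.
    rewrite le_eqVlt => /predU1P[<-|t0]; first by rewrite sin0 normr0.
    have [c _ ] := @MVT R (@sin R) (@cos R) 0 t t0 (fun x _ => is_derive_sin x)
      (continuous_subspaceT (@continuous_sin R)).
    rewrite sin0 !subr0 => ->; rewrite normrM (gtr0_norm t0) ler_piMl ?(ltW t0) //.
    exact: cos_max.
  have [x0|x0] := ger0P x; first by rewrite aux.
  by rewrite -normrN -sinN aux // oppr_ge0 ltW.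
have := cos_mulr2n (y / 2); rewrite (_ : y / 2 *+ 2 = y) => [->|]; last by rewrite -mulr_natr; lra.
have h := sinle (y / 2); rewrite cos2sin2.
rewrite (_ : _ - 1 = - (2 * sin (y / 2) ^+ 2)); last by rewrite -mulr_natr; ring.
rewrite normrN ger0_norm; last by rewrite mulr_ge0 // sqr_ge0.
rewrite -[sin _ ^+ 2]real_normK ?num_real //.
have : `|sin (y / 2)| ^+ 2 <= `|y / 2| ^+ 2 by rewrite ler_sqr ?nnegrE.
by rewrite [X in _ <= X]real_normK ?num_real // exprMn; have := sqr_ge0 y; lra.
Qed.

(** By the mean value theorem sin t - t = (cos c - 1) t with 0 < c < t, so the crude bound |cos c -
    1| <= c is enough. *)
Lemma sin_taylor1 (y : R) : `|sin y - y| <= y ^+ 2.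
Proof.
have cos1 (x : R) : `|cos x - 1| <= `|x|.
  have [x1|x1] := lerP `|x| 1.
    apply: le_trans (cos_sub1_bound x) _; rewrite -[x ^+ 2]real_normK ?num_real //.
    by rewrite expr2 ler_piMl.
  have := cos_max x; rewrite ler_norml => /andP[h1 h2].
  have [x2|x2] := lerP 2 `|x|; first by rewrite ler_norml; lra.
  suff : 0 <= cos x + `|x| - 1 by rewrite ler_norml; lra.
  have aux (t : R) : 0 <= t -> `|cos t - 1| <= t.
    rewrite le_eqVlt => /predU1P[<-|t0]; first by rewrite cos0 subrr normr0.
    have [c _ ] := @MVT R (@cos R) _ 0 t t0 (fun x _ => is_derive_cos x)
      (continuous_subspaceT (@continuous_cos R)).
    rewrite cos0 !subr0 => ->; rewrite normrM (gtr0_norm t0) ler_piMl ?(ltW t0) //.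
    by rewrite normrN; exact: sin_max.
  by have := aux `|x| (normr_ge0 x); rewrite cos_norm ler_norml; lra.
have aux (t : R) : 0 <= t -> `|sin t - t| <= t ^+ 2.
  rewrite le_eqVlt => /predU1P[<-|t0]; first by rewrite sin0 subrr normr0 expr0n.
  have [c] := @MVT R (@sin R) (@cos R) 0 t t0 (fun x _ => is_derive_sin x)
    (continuous_subspaceT (@continuous_sin R)).
  rewrite in_itv /= => /andP[c0 ct]; rewrite sin0 !subr0 => ->.
  rewrite (_ : _ - t = (cos c - 1) * t); last by ring.
  rewrite normrM (gtr0_norm t0) expr2 ler_wpM2r ?(ltW t0) //.
  by apply: le_trans (cos1 c) _; rewrite gtr0_norm // ltW.
have [y0|y0] := ger0P y; first exact: aux.
rewrite -normrN opprD opprK -sinN -sqrrN -[y in _ + y]opprK.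
by rewrite aux // oppr_ge0 ltW.
Qed.

Lemma cmod_le_ReIm z : cmod z <= `|complex.Re z| + `|complex.Im z|.
Proof.
rewrite [z in X in X <= _]complexE; apply: le_trans (cmodD _ _) _.
rewrite cmodM !cmod_real (_ : cmod 'i = 1) ?mul1r //.
by rewrite /cmod /= expr0n expr1n add0r sqrtr1.
Qed.

(** The real and imaginary parts of the remainder split into four errors [b1] to [b4], each at most
    r^2 exp r with r the modulus of w. *)
Lemma cexp_taylor1 w : cmod (cexp w - 1 - w) <= 5 * cmod w ^+ 2 * expR (cmod w).
Proof.
have hre := cmod_ge_Re w; have him := cmod_ge_Im w.
case: w hre him => x y /=; set r := cmod _ => hre him.
have r0 : 0 <= r by exact: cmod_ge0.
have x2 : x ^+ 2 <= r ^+ 2 by rewrite -[x ^+ 2]real_normK ?num_real // ler_sqr ?nnegrE.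
have y2 : y ^+ 2 <= r ^+ 2 by rewrite -[y ^+ 2]real_normK ?num_real // ler_sqr ?nnegrE.
have xy : `|x| * `|y| <= r ^+ 2 by rewrite expr2 ler_pM.
have ex : expR `|x| <= expR r by rewrite ler_expR.
have ex' : expR x <= expR r by rewrite ler_expR (le_trans _ hre) // ler_norm.
have e0 := expR_gt0 x; have e1 := expR_gt0 `|x|.
apply: le_trans (cmod_le_ReIm _) _ => /=; rewrite oppr0 addr0.
rewrite (_ : expR x * cos y - 1 - x
   = (expR x - 1 - x) + expR x * (cos y - 1)); last by ring.
rewrite (_ : expR x * sin y - y
   = expR x * (sin y - y) + (expR x - 1) * y); last by ring.
rewrite (_ : 5 * r ^+ 2 * expR r = (r ^+ 2 * expR r + expR r * r ^+ 2)
   + (expR r * r ^+ 2 + r ^+ 2 * expR r) + r ^+ 2 * expR r); last by ring.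
have b1 : `|expR x - 1 - x| <= r ^+ 2 * expR r.
  by apply: le_trans (expR_taylor1 x) _; rewrite ler_pM ?sqr_ge0 ?expR_ge0.
have b2 : `|expR x * (cos y - 1)| <= expR r * r ^+ 2.
  rewrite normrM (gtr0_norm e0) ler_pM // ?expR_ge0 //.
  exact: le_trans (cos_sub1_bound y) _.
have b3 : `|expR x * (sin y - y)| <= expR r * r ^+ 2.
  rewrite normrM (gtr0_norm e0) ler_pM // ?expR_ge0 //.
  exact: le_trans (sin_taylor1 y) _.
have b4 : `|(expR x - 1) * y| <= r ^+ 2 * expR r.
  rewrite normrM; apply: (@le_trans _ _ (`|x| * expR `|x| * `|y|)).
    by rewrite ler_wpM2r // expR_sub1_bound.
  by rewrite mulrAC ler_pM // ?mulr_ge0 // ?expR_ge0.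
have b5 : 0 <= r ^+ 2 * expR r by rewrite mulr_ge0 // ?sqr_ge0 ?expR_ge0.
have := ler_normD (expR x - 1 - x) (expR x * (cos y - 1)).
have := ler_normD (expR x * (sin y - y)) ((expR x - 1) * y).
lra.
Qed.

End ComplexExp.

(** * Rapidly decreasing Fourier series on C^3 and their termwise derivatives *)

Section FourierSeries.
Variable R : realType.
Local Notation vec := 'cV[C R]_3.
Local Notation lat := 'cV[int]_3.
Implicit Types (m : lat) (z h : vec) (c : lat -> C R).

Definition norm1 (m : lat) : nat := \sum_(i < 3) `|m i 0%R|%N.

Definition piI : C R := 0 +i* pi.

Definition dotz (m : lat) (z : vec) : C R := ((intv R m)^T *m z) 0 0.

Definition expdot (m : lat) (z : vec) : C R := cexp (2 * piI * dotz m z).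

Definition fourier (c : lat -> C R) (z : vec) : C R :=
  sum (fun m => c m * expdot m z).

(** Decay faster than every geometric rate. At complex z the characters grow like B^|m| with B
    depending on z, so this is what makes the series converge on all of C^3, along with its
    derivatives. *)
Definition rapid (c : lat -> C R) :=
  forall B : R, 0 <= B -> exists M : R, forall m, cmod (c m) * B ^+ norm1 m <= M.

Lemma dotzE m z : dotz m z = \sum_i (m i 0)%:~R * z i 0.
Proof. by rewrite /dotz mxE; apply: eq_bigr => i _; rewrite !mxE. Qed.

Lemma dotzD m z h : dotz m (z + h) = dotz m z + dotz m h.
Proof. by rewrite /dotz mulmxDr mxE. Qed.

Lemma dotzZ m (a : C R) z : dotz m (a *: z) = a * dotz m z.
Proof. by rewrite /dotz -scalemxAr mxE. Qed.

Lemma dotzDl m n z : dotz (m + n) z = dotz m z + dotz n z.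
Proof. by rewrite /dotz /intv map_mxD linearD mulmxDl mxE. Qed.

Lemma dotzNl m z : dotz (- m) z = - dotz m z.
Proof. by rewrite /dotz /intv map_mxN linearN mulNmx mxE. Qed.

Lemma dotzMnl m n z : dotz (m *+ n) z = dotz m z *+ n.
Proof.
elim: n => [|n IH]; last by rewrite !mulrS dotzDl IH.
by rewrite dotzE big1 // => i _; rewrite mxE mul0r.
Qed.

Lemma expdotD m z h : expdot m (z + h) = expdot m z * expdot m h.
Proof. by rewrite /expdot dotzD mulrDr cexpD. Qed.

Lemma expdotDl m n z : expdot (m + n) z = expdot m z * expdot n z.
Proof. by rewrite /expdot dotzDl mulrDr cexpD. Qed.

Lemma cmod_intr (k : int) : cmod (k%:~R : C R) = `|k|%N%:R.
Proof.
rewrite (_ : k%:~R = (k%:~R : R)%:C) ?cmod_real; last by rewrite rmorph_int.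
by rewrite -intr_norm -[in LHS]abszE.
Qed.

Lemma cmod_dotz m z (r : R) : (forall i, cmod (z i 0) <= r) ->
  cmod (dotz m z) <= r * (norm1 m)%:R.
Proof.
move=> hr; rewrite dotzE; apply: le_trans (cmod_sum _ _ _) _.
rewrite /norm1 natr_sum mulr_sumr; apply: ler_sum => i _.
by rewrite cmodM cmod_intr mulrC ler_wpM2r.
Qed.

Lemma cmod_2piI : cmod (2 * piI) = 2 * pi.
Proof.
rewrite cmodM; congr (_ * _).
  by rewrite (_ : 2 = (2 : R)%:C) ?cmod_real ?ger0_norm // rmorph_nat.
by rewrite /cmod /= expr0n add0r sqrtr_sqr ger0_norm // pi_ge0.
Qed.

Lemma cmod_expdot m z (r : R) : (forall i, cmod (z i 0) <= r) ->
  cmod (expdot m z) <= expR (2 * pi * r) ^+ norm1 m.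
Proof.
move=> hr; apply: le_trans (cmod_cexp_le _) _.
rewrite -expRM_natr ler_expR cmodM cmod_2piI -[X in _ <= X]mulrA.
by rewrite ler_wpM2l ?cmod_dotz // mulr_ge0 // pi_ge0.
Qed.

Lemma entry_bound z : exists2 r : R, 0 <= r & forall i, cmod (z i 0) <= r.
Proof.
exists (\sum_i cmod (z i 0)); first by apply: sumr_ge0 => i _; exact: cmod_ge0.
move=> i; rewrite (bigD1 i) //= lerDl.
by apply: sumr_ge0 => j _; exact: cmod_ge0.
Qed.

(** The summable weight against which every series is compared. Its total over Z^3 is 3^3 = 27,
    since 1 + 2 (1/2 + 1/4 + ...) = 3. *)
Definition halfw (m : lat) : R := 2^-1 ^+ norm1 m.

Lemma halfw_sum1 L :
  \sum_(0 <= a < (L.*2).+1) (2^-1 : R) ^+ `|a%:Z - L%:Z|%N = 3 - 2 * 2^-1 ^+ L.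
Proof.
elim: L => [|L IH]; first by rewrite big_nat1 subrr expr0; ring.
rewrite doubleS big_nat_recr //= big_nat_recl //=.
rewrite (eq_bigr (fun a : nat => (2^-1 : R) ^+ `|a%:Z - L%:Z|%N)); last first.
  by move=> a _; congr (_ ^+ absz _); lia.
rewrite IH subn0 (_ : absz _ = L.+1); last lia.
by rewrite exprS; field.
Qed.

Lemma halfw_sum (K : {fset lat}) : \sum_(m <- K) halfw m <= 27.
Proof.
(* The finite set K is enclosed in the cube [-L, L]^3, parametrized by [phi]; over the cube the
   weight factors into three one-dimensional sums. *)
pose L := \max_(m <- K) norm1 m.
pose phi (t : {ffun 'I_3 -> 'I_(L.*2).+1}) : lat :=
  \col_i ((t i)%:Z - L%:Z).
have leL m : m \in (K : seq lat) -> (norm1 m <= L)%N.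
  by move=> mK; rewrite /L; exact: (@leq_bigmax_seq _ _ xpredT).
have surj m : m \in (K : seq lat) -> exists t, phi t = m.
  move=> /leL mL.
  have bd i : (absz (m i 0%R + L%:Z)%R < L.*2.+1)%N /\ (0 <= m i 0 + L%:Z).
    have : (`|m i 0%R|%N <= norm1 m)%N by rewrite /norm1 (bigD1 i) //= leq_addr.
    by move=> h; split; lia.
  exists [ffun i => Ordinal (bd i).1]; apply/colP => i; rewrite mxE ffunE /=.
  by have := (bd i).2; lia.
(* Each m of K is hit by some t, so indicator sums over t dominate; after exchanging the sums, each
   t is counted at most once because K has no repetitions. *)
apply: (@le_trans _ _ (\sum_(m <- K) \sum_t (phi t == m)%:R * halfw (phi t))).
  rewrite big_seq [X in _ <= X]big_seq; apply: ler_sum => m /surj[t tm].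
  rewrite (bigD1 t) //= tm eqxx mul1r lerDl; apply: sumr_ge0 => u _.
  by rewrite mulr_ge0 // exprn_ge0 // invr_ge0.
rewrite exchange_big /=.
apply: (@le_trans _ _ (\sum_t halfw (phi t))).
  apply: ler_sum => t _; rewrite -mulr_suml ler_piMl //.
    by rewrite exprn_ge0 // invr_ge0.
  rewrite -natr_sum (_ : \sum_(m <- K) _ = count_mem (phi t) K).
    by rewrite count_uniq_mem ?fset_uniq //; case: (_ \in _).
  rewrite -sum1_count [RHS]big_mkcond /=; apply: eq_bigr => m _.
  by rewrite eq_sym; case: eqP.
rewrite (eq_bigr (fun t : {ffun 'I_3 -> 'I_(L.*2).+1} =>
   \prod_i (2^-1 : R) ^+ `|(t i)%:Z - L%:Z|%N)); last first.
  move=> t _; rewrite /halfw /norm1 expr_sum; apply: eq_bigr => i _.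
  by rewrite mxE.
rewrite -(bigA_distr_bigA (fun _ (a : 'I_(L.*2).+1) => (2^-1 : R) ^+ `|a%:Z - L%:Z|%N)).
rewrite (eq_bigr (fun=> (3 - 2 * 2^-1 ^+ L : R))); last first.
  by move=> i _; rewrite -halfw_sum1 big_mkord.
rewrite prodr_const card_ord (_ : 27 = 3 ^+ 3); last by ring.
have h : 0 <= (2^-1 : R) ^+ L by rewrite exprn_ge0 // invr_ge0.
have h1 : (2^-1 : R) ^+ L <= 1 by rewrite exprn_ile1 ?invr_ge0 // invf_le1 // ler1n.
by rewrite lerXn2r ?nnegrE //; lra.
Qed.

Lemma abs_sum_halfw (f : lat -> C R) (M : R) :
  (forall m, cmod (f m) <= M * halfw m) -> abs_sum_le f (M * 27).
Proof.
move=> hM K; have M0 : 0 <= M.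
  have := hM 0; rewrite (_ : halfw 0 = 1) ?mulr1.
    by apply: le_trans; exact: cmod_ge0.
  by rewrite /halfw /norm1 big1 ?expr0 // => i _; rewrite mxE.
apply: (@le_trans _ _ (\sum_(m <- K) M * halfw m)); first by apply: ler_sum.
by rewrite -mulr_sumr ler_wpM2l // halfw_sum.
Qed.

(** Rapid decay at rate 2B leaves a factor 2^-|m| to spare at rate B. *)
Lemma rapid_halfw c (B : R) : rapid c -> 0 <= B ->
  exists2 M : R, 0 <= M & forall m, cmod (c m) * B ^+ norm1 m <= M * halfw m.
Proof.
move=> hc B0; have [|M hM] := hc (2 * B); first by rewrite mulr_ge0.
exists M => [|m].
  by apply: le_trans (hM 0); rewrite mulr_ge0 ?cmod_ge0 // exprn_ge0 // mulr_ge0.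
rewrite /halfw exprVn ler_pdivlMr ?exprn_gt0 //.
by rewrite -mulrA -exprMn [B * 2]mulrC.
Qed.

Lemma fourier_has_sum c z : rapid c ->
  has_sum (fun m => c m * expdot m z) (fourier c z).
Proof.
move=> hc; have [r r0 hr] := entry_bound z.
have [M M0 hM] := rapid_halfw hc (expR_ge0 (2 * pi * r)).
apply: (@abs_sumE _ _ _ (M * 27)); apply: abs_sum_halfw => m.
apply: le_trans (hM m); rewrite cmodM ler_wpM2l ?cmod_ge0 //.
exact: cmod_expdot.
Qed.

Lemma rapidM_norm1 c (f : lat -> C R) (K : R) : 0 <= K ->
  (forall m, cmod (f m) <= K * 2 ^+ norm1 m) ->
  rapid c -> rapid (fun m => f m * c m).
Proof.
move=> K0 hf hc B B0; have [|M hM] := hc (2 * B); first by rewrite mulr_ge0.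
exists (K * M) => m; rewrite cmodM.
apply: le_trans (_ : K * 2 ^+ norm1 m * (cmod (c m) * B ^+ norm1 m) <= _).
  by rewrite -mulrA ler_wpM2r // mulr_ge0 ?cmod_ge0 // exprn_ge0.
have := hM m; rewrite exprMn => h.
rewrite -mulrA ler_wpM2l // (le_trans _ h) //.
by rewrite mulrCA.
Qed.

Lemma natr_le_exp2 n : n%:R <= (2 : R) ^+ n.
Proof. by rewrite -natrX ler_nat ltnW // ltn_expl. Qed.

Definition dcoef (i : 'I_3) c (m : lat) : C R := 2 * piI * (m i 0)%:~R * c m.

Lemma rapid_dcoef i c : rapid c -> rapid (dcoef i c).
Proof.
apply: (@rapidM_norm1 _ _ (2 * pi)) => [|m]; first by rewrite mulr_ge0 // pi_ge0.
rewrite cmodM cmod_2piI ler_wpM2l ?mulr_ge0 ?pi_ge0 // cmod_intr.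
apply: le_trans (natr_le_exp2 _); rewrite ler_nat /norm1.
by rewrite (bigD1 i) //= leq_addr.
Qed.

Lemma rapidD c c' : rapid c -> rapid c' -> rapid (fun m => c m + c' m).
Proof.
move=> h h' B B0; have [M hM] := h _ B0; have [M' hM'] := h' _ B0.
exists (M + M') => m; apply: le_trans (lerD (hM m) (hM' m)).
by rewrite -mulrDl ler_wpM2r ?exprn_ge0 // cmodD.
Qed.

Lemma rapidZ (a : C R) c : rapid c -> rapid (fun m => a * c m).
Proof.
apply: (@rapidM_norm1 _ (fun=> a) (cmod a)) => [|m]; first exact: cmod_ge0.
by rewrite ler_peMr ?cmod_ge0 // exprn_ege1 // ler1n.
Qed.

Lemma rapid0 : rapid (fun=> 0).
Proof. by move=> B B0; exists 0 => m; rewrite cmod0 mul0r. Qed.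

Lemma rapid_le c c' : (forall m, cmod (c' m) <= cmod (c m)) -> rapid c -> rapid c'.
Proof.
move=> le h B B0; have [M hM] := h _ B0; exists M => m.
by apply: le_trans (hM m); rewrite ler_wpM2r ?exprn_ge0.
Qed.

(** The remainder is the sum of the remainders of the single characters, each estimated by
    [cexp_taylor1]; rapid decay absorbs the growth in m. *)
Lemma fourier_taylor1 c z : rapid c -> exists K : R, forall h (r : R),
  r <= 1 -> (forall i, cmod (h i 0) <= r) ->
  cmod (fourier c (h + z) - fourier c z
        - \sum_i fourier (dcoef i c) z * h i 0) <= K * r ^+ 2.
Proof.
move=> hc; have [A A0 hA] := entry_bound z.
(* With N = |m|: exp (2 pi A)^N bounds the character at z, 4^N bounds the factor N^2 of the
   quadratic remainder, and exp (2 pi)^N bounds its exponential factor, since r <= 1. *)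
pose B : R := expR (2 * pi * A) * (4 * expR (2 * pi)).
have B0 : 0 <= B by rewrite !mulr_ge0 ?expR_ge0.
have [M M0 hM] := rapid_halfw hc B0.
exists (5 * (2 * pi) ^+ 2 * M * 27) => h r r1 hr.
have r0 : 0 <= r by apply: le_trans (hr 0); exact: cmod_ge0.
pose T m := c m * expdot m z * (expdot m h - 1 - 2 * piI * dotz m h).
have hT : has_sum T (fourier c (h + z) - fourier c z
        - \sum_i fourier (dcoef i c) z * h i 0).
  rewrite -[X in has_sum _ (_ + X - _)]mulN1r -[X in has_sum _ (_ - X)]mul1r.
  rewrite -mulNr.
  have := has_sumD (has_sumD (fourier_has_sum (h + z) hc)
    (has_sumZ (-1) (fourier_has_sum z hc))) (has_sumZ (-1)
    (has_sum_sum (index_enum 'I_3) (fun i => has_sumZ (h i 0)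
      (fourier_has_sum z (rapid_dcoef i hc))))).
  rewrite (eq_bigr (fun i => fourier (dcoef i c) z * h i 0)); last first.
    by move=> i _; rewrite mulrC.
  congr has_sum; apply: funext => m.
  rewrite (_ : \sum_j _ = c m * expdot m z * (2 * piI * dotz m h)).
    by rewrite /T expdotD; ring.
  rewrite dotzE !mulr_sumr; apply: eq_bigr => i _; rewrite /dcoef; ring.
apply: has_sum_le hT _.
rewrite (_ : _ * r ^+ 2 = 5 * (2 * pi) ^+ 2 * M * r ^+ 2 * 27); last by ring.
apply: abs_sum_halfw => m.
set N := norm1 m; set w := 2 * piI * dotz m h.
have hw : cmod w <= 2 * pi * r * N%:R.
  rewrite cmodM cmod_2piI -[X in _ <= X]mulrA ler_wpM2l ?mulr_ge0 ?pi_ge0 //.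
  exact: cmod_dotz.
have hw2 : cmod w ^+ 2 <= (2 * pi) ^+ 2 * r ^+ 2 * 4 ^+ N.
  apply: (@le_trans _ _ ((2 * pi * r * N%:R) ^+ 2)).
    by rewrite lerXn2r ?nnegrE ?cmod_ge0 // !mulr_ge0 ?pi_ge0.
  rewrite [X in X <= _]exprMn [(2 * pi * r) ^+ 2]exprMn.
  apply: ler_wpM2l; first by rewrite mulr_ge0 // sqr_ge0.
  rewrite (_ : 4 = (2 : R) ^+ 2); last by ring.
  by rewrite exprAC lerXn2r ?nnegrE ?exprn_ge0 // natr_le_exp2.
have hw3 : expR (cmod w) <= expR (2 * pi) ^+ N.
  rewrite -expRM_natr ler_expR (le_trans hw) //.
  by rewrite ler_wpM2r // ler_piMr // mulr_ge0 // pi_ge0.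
rewrite /T cmodM cmodM.
apply: (@le_trans _ _ (cmod (c m) * expR (2 * pi * A) ^+ N
   * (5 * ((2 * pi) ^+ 2 * r ^+ 2 * 4 ^+ N) * expR (2 * pi) ^+ N))).
  apply: ler_pM; rewrite ?mulr_ge0 ?cmod_ge0 //.
    by rewrite ler_wpM2l ?cmod_ge0 // cmod_expdot.
  apply: le_trans (cexp_taylor1 w) _.
  have e1 : 0 <= 5 * cmod w ^+ 2 by rewrite mulr_ge0 // sqr_ge0.
  by rewrite ler_pM ?expR_ge0 // ler_wpM2l.
have := hM m; rewrite /B -/N !exprMn => h1.
rewrite (_ : _ * _ = 5 * (2 * pi) ^+ 2 * r ^+ 2 * (cmod (c m) *
   (expR (2 * pi * A) ^+ N * (4 ^+ N * expR (2 * pi) ^+ N)))); last by ring.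
rewrite [X in _ <= X](_ : _ = 5 * (2 * pi) ^+ 2 * r ^+ 2 * (M * halfw m)); last by ring.
apply: ler_wpM2l => //; apply: mulr_ge0; last exact: sqr_ge0.
by apply: mulr_ge0 => //; exact: sqr_ge0.
Qed.

End FourierSeries.

(** * Complex differentiability and a ring of entire functions stable under derivation *)

Lemma mx_entry_le (K : numFieldType) (m n : nat) (h : 'M[K]_(m, n)) i j :
  `|h i j| <= `|h|.
Proof.
rewrite real_leNgt ?ger0_real //; apply/negP => lt.
have : ball (0 : 'M[K]_(m, n)) `|h i j| h by rewrite -ball_normE /= sub0r normrN.
by case=> _ /(_ i j); rewrite -ball_normE /= mxE sub0r normrN ltxx.
Qed.

Section Differentiability.
Variable R : realType.
Local Notation vec := 'cV[C R]_3.
Local Notation lat := 'cV[int]_3.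
Local Notation fn := (vec -> C R).
Implicit Types (z h : vec) (f g : fn) (c : lat -> C R).

Lemma cmod_entry_le h i : cmod (h i 0) <= complex.Re `|h|.
Proof.
have hr : `|h| \is Num.real by rewrite ger0_real.
by have := mx_entry_le h i 0; rewrite -(RRe_real hr) normrE_cmod lecR.
Qed.

(** A quadratic remainder is o(h), so the linear map with coefficients [a] is the Fréchet
    derivative, and its values on the unit vectors are the partial derivatives. *)
Lemma differentiable_taylor1 f z (a : 'I_3 -> C R) (K : R) :
  (forall h (r : R), r <= 1 -> (forall i, cmod (h i 0) <= r) ->
    cmod (f (h + z) - f z - \sum_i a i * h i 0) <= K * r ^+ 2) ->
  differentiable f z /\ forall i, partial i f z = a i.
Proof.
move=> hK; pose L0 h : C R := \sum_i a i * h i 0.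
have linL0 : linear L0.
  move=> k u v; rewrite /L0 scaler_sumr -big_split; apply: eq_bigr => i _ /=.
  by rewrite !mxE mulrDr scalerAr.
pose L : {linear vec -> C R} := HB.pack L0 (GRing.isLinear.Build _ _ _ _ _ linL0).
have contL : continuous L.
  move=> x; apply: differentiable_continuous.
  rewrite (_ : L = \sum_(i < 3) (fun h : vec => a i * h i 0) :> fn).
    apply: differentiable_sum => i; apply: (differentiableM (f := fun=> a i)).
      exact: differentiable_cst.
    exact: differentiable_coord.
  by apply: funext => h; rewrite fct_sumE.
have [_ littleo] := @eqaddoP _ _ (C R) vec (nbhs (0 : vec)) (f \o shift z)
  (cst (f z) + L0 : fn) id.
lapply littleo => {littleo} [exL|e e0].
  have dE := @diff_unique _ vec (C R) f L z contL exL.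
  have dif : differentiable f z by apply/diff_locallyP; rewrite dE.
  split=> // i; rewrite /partial deriveE // dE /L /= /L0 (bigD1 i) //= big1 => [|j ji].
    by rewrite mxE !eqxx mulr1 addr0.
  by rewrite mxE (negbTE ji) mulr0.
have er : e \is Num.real by rewrite gtr0_real.
rewrite -(RRe_real er) in e0 *; rewrite ltcR in e0.
set ee : R := complex.Re e in e0 *.
pose K1 := `|K| + 1; have K10 : 0 < K1 by rewrite ltr_wpDl.
(* The bound 1 is the range in which the hypothesis holds; the other bound gives K1 r <= ee, hence K
   r^2 <= ee r. *)
pose d : R := Num.min 1 (ee / K1).
have d0 : 0 < d by rewrite lt_min ltr01 divr_gt0.
apply/nbhs_ballP; exists d%:C; first by rewrite /= ltcR.
move=> h /=; rewrite -ball_normE /= sub0r normrN.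
have hr : `|h| \is Num.real by rewrite ger0_real.
rewrite -(RRe_real hr) ltcR; set r := complex.Re _.
rewrite lt_min => /andP[r1 r2].
rewrite -[_ h in X in X <= _]/(f (h + z) - (f z + L0 h)) opprD addrA.
rewrite normrE_cmod -rmorphM lecR; apply: le_trans (hK h r (ltW r1) _) _.
  by move=> i; exact: cmod_entry_le.
have r0 : 0 <= r by apply: le_trans (cmod_entry_le h 0); exact: cmod_ge0.
rewrite expr2 mulrA ler_wpM2r //; apply: (@le_trans _ _ (K1 * r)).
  by rewrite ler_wpM2r // /K1; have := ler_norm K; lra.
by rewrite ltr_pdivlMr // in r2; rewrite mulrC ltW.
Qed.

Lemma fourier_differentiable c z : rapid c -> differentiable (fourier c) z.
Proof. by move=> /(fourier_taylor1 z)[K /differentiable_taylor1[]]. Qed.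

Lemma partial_fourier i c : rapid c ->
  partial i (fourier c) = fourier (dcoef i c).
Proof.
move=> hc; apply: funext => z; have [K hK] := fourier_taylor1 z hc.
by have [_ ->] := differentiable_taylor1 hK.
Qed.

(* An opaque copy of [partial], which unification cannot unfold to a limit. *)
Fact pd_key : unit. Proof. exact: tt. Qed.
Definition pd : 'I_3 -> fn -> fn := locked_with pd_key (@partial R).

Lemma pdE : pd = @partial R. Proof. exact: unlock. Qed.

Lemma pd_fourier i c : rapid c -> pd i (fourier c) = fourier (dcoef i c).
Proof. by rewrite pdE; exact: partial_fourier. Qed.

Lemma pdD i f g z : differentiable f z -> differentiable g z ->
  pd i (fun x => f x + g x) z = pd i f z + pd i g z.
Proof. by move=> df dg; rewrite pdE; apply: deriveD; exact: diff_derivable. Qed.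

Lemma pdM i f g z : differentiable f z -> differentiable g z ->
  pd i (fun x => f x * g x) z = pd i f z * g z + f z * pd i g z.
Proof.
move=> df dg; rewrite pdE /partial (_ : (fun x => _) = f * g) // deriveM;
  [|exact: diff_derivable..].
by rewrite addrC mulrC.
Qed.

Lemma pd_cst i (a : C R) z : pd i (fun=> a) z = 0.
Proof. by rewrite pdE /partial derive_cst. Qed.

Lemma pdZ i (a : C R) f z : differentiable f z ->
  pd i (fun x => a * f x) z = a * pd i f z.
Proof.
move=> df; rewrite (@pdM i (fun=> a) f) //.
  by rewrite pd_cst mul0r add0r.
Qed.

Lemma pdV i f z : f z != 0 -> differentiable f z ->
  pd i (fun x => (f x)^-1) z = - pd i f z / f z ^+ 2.
Proof.
move=> f0 df; rewrite pdE /partial deriveV //; last exact: diff_derivable.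
by rewrite -[_ *: _]/(_ * _) mulrC mulrN mulNr.
Qed.

(** Stability under [pd] and commutation of partial derivatives are proved by induction on this
    construction; both rest on the termwise derivative of a Fourier series and the Leibniz rule. *)
Inductive entire_ring : fn -> Prop :=
| entire_fourier c : rapid c -> entire_ring (fourier c)
| entire_cst a : entire_ring (fun=> a)
| entireD f g : entire_ring f -> entire_ring g -> entire_ring (fun z => f z + g z)
| entireM f g : entire_ring f -> entire_ring g -> entire_ring (fun z => f z * g z).

Lemma entire_ring_entire f : entire_ring f -> entire f.
Proof.
elim=> [c hc z|a z|{}f g _ hf _ hg z|{}f g _ hf _ hg z].
- exact: fourier_differentiable.
- exact: differentiable_cst.
- exact: (differentiableD (hf z) (hg z)).
- exact: (differentiableM (hf z) (hg z)).
Qed.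

Lemma entire_ring_pd i f : entire_ring f -> entire_ring (pd i f).
Proof.
elim=> [c hc|a|{}f g ef hf eg hg|{}f g ef hf eg hg].
- by rewrite pd_fourier //; apply/entire_fourier/rapid_dcoef.
- rewrite (_ : pd i _ = fun=> 0); first exact: entire_cst.
  by apply: funext => z; rewrite pd_cst.
- rewrite (_ : pd i _ = fun z => pd i f z + pd i g z).
    exact: entireD.
  by apply: funext => z; rewrite -pdD //; exact: entire_ring_entire.
- rewrite (_ : pd i _ = fun z => pd i f z * g z + f z * pd i g z).
    by apply: entireD; apply: entireM.
  by apply: funext => z; rewrite -pdM //; exact: entire_ring_entire.
Qed.

Lemma entire_ring_pdC i j f : entire_ring f ->
  pd i (pd j f) = pd j (pd i f).
Proof.
elim=> [c hc|a|{}f g ef hf eg hg|{}f g ef hf eg hg].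
- rewrite !pd_fourier //; try exact: rapid_dcoef.
  by congr fourier; apply: funext => m; rewrite /dcoef; ring.
- have E k : pd k (fun=> a) = fun=> 0 :> C R.
    by apply: funext => z; rewrite pd_cst.
  by rewrite !E; apply: funext => z; rewrite !pd_cst.
- have E k : pd k (fun z => f z + g z) = fun z => pd k f z + pd k g z.
    by apply: funext => z; rewrite -pdD //; exact: entire_ring_entire.
  rewrite !E; apply: funext => z.
  have d k (h : fn) : entire_ring h -> differentiable (pd k h) z.
    by move=> eh; exact/entire_ring_entire/entire_ring_pd.
  rewrite (@pdD i (pd j f) (pd j g) z (d _ _ ef) (d _ _ eg)).
  by rewrite (@pdD j (pd i f) (pd i g) z (d _ _ ef) (d _ _ eg)) hf hg.
- have E k : pd k (fun z => f z * g z)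
      = fun z => pd k f z * g z + f z * pd k g z.
    apply: funext => z; apply: (@pdM k f g);
      [exact: (entire_ring_entire ef) | exact: (entire_ring_entire eg)].
  have E2 k l z : pd k (fun z => pd l f z * g z + f z * pd l g z) z
     = pd k (pd l f) z * g z + pd l f z * pd k g z
     + (pd k f z * pd l g z + f z * pd k (pd l g) z).
    have d (h : fn) : entire_ring h -> differentiable h z.
      by move=> eh; exact: entire_ring_entire.
    have e1 := entire_ring_pd l ef; have e2 := entire_ring_pd l eg.
    rewrite (@pdD k (fun z => pd l f z * g z) (fun z => f z * pd l g z)).
    - rewrite (@pdM k (pd l f) g z (d _ e1) (d _ eg)).
      by rewrite (@pdM k f (pd l g) z (d _ ef) (d _ e2)).
    - exact/d/entireM.
    - exact/d/entireM.
  by rewrite !E; apply: funext => z; rewrite !E2 hf hg; ring.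
Qed.

Lemma entireN f : entire_ring f -> entire_ring (fun z => - f z).
Proof.
move=> ef; rewrite (_ : (fun _ => _) = fun z => -1 * f z).
  by apply: entireM => //; exact: entire_cst.
by apply: funext => z; rewrite mulN1r.
Qed.

Lemma entireB f g : entire_ring f -> entire_ring g ->
  entire_ring (fun z => f z - g z).
Proof. by move=> ef eg; apply: entireD => //; exact: entireN. Qed.

Lemma entireX n f : entire_ring f -> entire_ring (fun z => f z ^+ n).
Proof.
move=> ef; elim: n => [|n IH].
  rewrite (_ : (fun _ => _) = fun=> 1); first exact: entire_cst.
  by apply: funext => z; rewrite expr0.
rewrite (_ : (fun _ => _) = fun z => f z * f z ^+ n); first exact: entireM.
by apply: funext => z; rewrite exprS.
Qed.

Lemma entire_sum (T : Type) (r : seq T) (F : T -> fn) :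
  (forall t, entire_ring (F t)) -> entire_ring (fun z => \sum_(t <- r) F t z).
Proof.
move=> hF; elim: r => [|t r IH].
  rewrite (_ : (fun _ => _) = fun=> 0); first exact: entire_cst.
  by apply: funext => z; rewrite big_nil.
rewrite (_ : (fun _ => _) = fun z => F t z + \sum_(t <- r) F t z).
  exact: entireD.
by apply: funext => z; rewrite big_cons.
Qed.

End Differentiability.

(** * Uniqueness of Fourier coefficients, without integration *)

Section FourierUniqueness.
Variable R : realType.
Local Notation vec := 'cV[C R]_3.
Local Notation lat := 'cV[int]_3.
Implicit Types (c : lat -> C R) (m k : lat) (z : vec).

Lemma has_sum_delta (I : choiceType) (i0 : I) (a : C R) :
  has_sum (fun i => if i == i0 then a else 0) a.
Proof.
move=> e e0; exists [fset i0]%fset => K; rewrite fsub1set => iK.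
rewrite (big_fsetD1 i0) //= eqxx big1_fset ?addr0 ?subrr ?cmod0 // => i.
by rewrite !inE => /andP[/negbTE-> _].
Qed.

Lemma cexp_2piI_int (q : int) : cexp (2 * piI R * q%:~R) = 1.
Proof.
rewrite mulrzr cexpMz (_ : cexp _ = 1) ?exp1rz // mulr_natl /cexp /piI /= addr0.
by rewrite expR0 mul1r -mulr2n cos2pi sin2pi mulr0.
Qed.

Lemma cexp_piI : cexp (piI R) = -1.
Proof.
rewrite /cexp /piI expR0 !mul1r cospi sinpi; apply/eqP.
by rewrite eq_complex /= oppr0 !eqxx.
Qed.

Lemma fourier0P c z : rapid c -> has_sum (fun m => c m * expdot m z) 0 <-> fourier c z = 0.
Proof.
move=> /(fourier_has_sum z) h; split=> [h0|h0]; first exact: has_sum_unique h h0.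
by rewrite -h0.
Qed.

Lemma rapid_if (P : pred lat) c : rapid c -> rapid (fun m => if P m then c m else 0).
Proof. by apply: rapid_le => m; case: (P m); rewrite // cmod0 cmod_ge0. Qed.

(** For m_i = 2^r q the character takes the value exp (pi i q) at this point, which is the parity
    sign of q. *)
Lemma expdot_half (i : 'I_3) (r : nat) m : (2 ^+ r %| m i 0%R)%Z ->
  expdot m ((2 ^+ r.+1)^-1 *: delta_mx i 0 : vec)
  = if (2 ^+ r.+1 %| m i 0%R)%Z then 1 else -1.
Proof.
move=> /dvdzP[q mq]; rewrite /expdot dotzZ.
rewrite (_ : dotz m _ = (m i 0)%:~R); last first.
  rewrite dotzE (bigD1 i) //= big1 => [|j ji]; last by rewrite mxE (negbTE ji) mulr0.
  by rewrite mxE !eqxx mulr1 addr0.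
rewrite mq (_ : (2 ^+ r.+1 %| q * 2 ^+ r)%Z = (2 %| q)%Z); last first.
  by rewrite exprS dvdz_mul2r // expf_neq0.
rewrite exprS.
have n0 : (2 : C R) ^+ r != 0 by rewrite expf_neq0 // pnatr_eq0.
have n2 : (2 : C R) != 0 by rewrite pnatr_eq0.
rewrite intrM rmorphXn /=.
rewrite (_ : 2 * piI R * _ = piI R * q%:~R); last by field; rewrite n0.
have := divz_eq q 2; case: ifPn => [/dvdzP[p ->] _|/negP nd q2].
  by rewrite -[RHS](cexp_2piI_int p); congr cexp; rewrite intrM; ring.
have {}q2 : q = (q %/ 2)%Z * 2 + 1.
  by move: nd => /negP; lia.
rewrite q2 intrD intrM mulrDr cexpD mulr1 cexp_piI.
rewrite (_ : piI R * _ = 2 * piI R * (q %/ 2)%Z%:~R); last first.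
  by ring.
by rewrite cexp_2piI_int mul1r.
Qed.

(* Averaging over a shift by half of the common period removes every second frequency. *)
Lemma fourier_eq0_halve (i : 'I_3) (r : nat) c : rapid c ->
  (forall z, fourier c z = 0) -> (forall m, c m != 0 -> (2 ^+ r %| m i 0%R)%Z) ->
  forall z, fourier (fun m => if (2 ^+ r.+1 %| m i 0%R)%Z then c m else 0) z = 0.
Proof.
move=> hc c0 cr z; apply/(fourier0P _ (rapid_if _ hc)).
have h z' : has_sum (fun m => c m * expdot m z') 0 by apply/fourier0P.
have := has_sumZ 2^-1
  (has_sumD (h z) (h (z + (2 ^+ r.+1)^-1 *: delta_mx i 0))).
rewrite addr0 mulr0; congr has_sum; apply: funext => m.
rewrite expdotD; have [->|/cr/expdot_half ->] := eqVneq (c m) 0.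
  by rewrite if_same !mul0r addr0 mulr0.
case: ifP => _; last by rewrite mul0r mulrN1 mulrN addrN mulr0.
by rewrite mulr1; field.
Qed.

(** The coefficients left after averaging over all 2^r-torsion translations. *)
Definition sub2 (r : nat) c m := if
  [&& (2 ^+ r %| m i1 0%R)%Z, (2 ^+ r %| m i2 0%R)%Z & (2 ^+ r %| m i3 0%R)%Z]
  then c m else 0.

Lemma fourier_eq0_sub2 r c : rapid c -> (forall z, fourier c z = 0) ->
  forall z, fourier (sub2 r c) z = 0.
Proof.
move=> hc c0; elim: r => [|r IH] z.
  rewrite (_ : sub2 0 c = c) //; apply: funext => m.
  by rewrite /sub2 !expr0 !dvd1z.
have step (i : 'I_3) c' : rapid c' /\ (forall z, fourier c' z = 0) /\
   (forall m, c' m != 0 -> sub2 r c m != 0) ->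
   let c'' := fun m => if (2 ^+ r.+1 %| m i 0%R)%Z then c' m else 0 in
   rapid c'' /\ (forall z, fourier c'' z = 0) /\
   (forall m, c'' m != 0 -> sub2 r c m != 0).
  move=> [h1 [h2 h3]] /=; split; first exact: rapid_if.
  split; last by move=> m; case: ifP => [_ /h3|]; rewrite ?eqxx.
  apply: fourier_eq0_halve => // m /h3; rewrite /sub2; case: and3P; rewrite ?eqxx //.
  case=> d1 d2 d3 _; case: i => [[|[|[|//]]]] lti.
  - by rewrite (_ : Ordinal lti = i1) //; exact: val_inj.
  - by rewrite (_ : Ordinal lti = i2) //; exact: val_inj.
  - by rewrite (_ : Ordinal lti = i3) //; exact: val_inj.
have [|_ [E _]] := step i1 _ (step i2 _ (step i3 (sub2 r c) _)).
  by split; [exact: rapid_if | split].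
rewrite -[RHS](E z); congr (fourier _ z); apply: funext => m.
have d n : (2 ^+ r.+1 %| n)%Z -> (2 ^+ r %| n)%Z.
  by move=> h; apply: dvdz_trans h; rewrite exprS dvdz_mull.
rewrite /sub2; case d1: (2 ^+ r.+1 %| m i1 0%R)%Z => //=.
case d2: (2 ^+ r.+1 %| m i2 0%R)%Z => //=.
by case d3: (2 ^+ r.+1 %| m i3 0%R)%Z => //=; rewrite (d _ d1) (d _ d2) (d _ d3).
Qed.

Lemma le_pow2_eq0 (x K : R) : 0 <= x -> (forall r, x <= K * 2^-1 ^+ r) -> x = 0.
Proof.
move=> x0 hx; apply/eqP; rewrite eq_le x0 andbT leNgt; apply/negP => xp.
have K0 : 0 <= K by have := hx 0%N; rewrite expr0 mulr1; apply: le_trans.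
have := archi_boundP (divr_ge0 K0 x0); set r := Num.bound _ => hr.
have := hx r; rewrite exprVn ler_pdivlMr ?exprn_gt0 // leNgt => /negP; apply.
rewrite ltr_pdivrMr // in hr; apply: lt_le_trans hr _.
by rewrite mulrC ler_wpM2l // natr_le_exp2.
Qed.

(** The restriction to frequencies in 2^r Z^3 still has sum zero. As r grows only the frequency 0
    survives, the others having total size O(2^-r), so the coefficient at 0 is arbitrarily small. *)
Lemma fourier_eq0_coef0 c : rapid c -> (forall z, fourier c z = 0) -> c 0 = 0.
Proof.
move=> hc c0; apply: cmod_eq0.
have [M M0 hM] := rapid_halfw hc (ler0n _ 2).
apply: (@le_pow2_eq0 _ (M * 27)); first exact: cmod_ge0.
move=> r; have hr : rapid (sub2 r c) by exact: rapid_if.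
have hs := fourier_has_sum 0 hr.
(* With the term at m = 0 removed, the series at z = 0 sums to - c 0. *)
have := has_sumD hs (has_sumZ (-1) (has_sum_delta (0 : lat) (c 0))).
rewrite fourier_eq0_sub2 // add0r mulN1r -cmodN mulrAC => /has_sum_le; apply.
apply: abs_sum_halfw => m.
have -> : expdot m (0 : vec) = 1.
  by rewrite /expdot (_ : dotz m 0 = 0) ?mulr0 ?cexp0 // /dotz mulmx0 mxE.
rewrite mulr1; have [->|m0] := eqVneq m 0.
  rewrite /sub2 !mxE !dvdz0 /= mulN1r subrr cmod0.
  by rewrite !mulr_ge0 ?exprn_ge0 // invr_ge0.
rewrite mulr0 addr0 /sub2; case: and3P => [[d1 d2 d3]|_]; last first.
  by rewrite cmod0 !mulr_ge0 ?exprn_ge0 // invr_ge0.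
rewrite mulrAC -ler_pdivrMr ?exprn_gt0 ?invr_gt0 // -exprVn invrK.
apply: le_trans (hM m); rewrite ler_wpM2l ?cmod_ge0 // ler_weXn2l ?ler1n //.
have [i mi] : exists i, m i 0 != 0.
  apply/existsP; apply: contraNT m0; rewrite negb_exists => /forallP h.
  by apply/eqP/colP => i; rewrite mxE; apply/eqP; rewrite -[_ == _]negbK h.
have di : (2 ^+ r %| m i 0%R)%Z.
  case: i mi => [[|[|[|//]]]] lti _.
  - by rewrite (_ : Ordinal lti = i1) //; exact: val_inj.
  - by rewrite (_ : Ordinal lti = i2) //; exact: val_inj.
  - by rewrite (_ : Ordinal lti = i3) //; exact: val_inj.
(* A non-zero coordinate divisible by 2^r has absolute value at least 2^r >= r, hence |m| >= r and
   the spare factor 2^-|m| is at most 2^-r. *)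
apply: (@leq_trans (absz (m i 0))); last by rewrite /norm1 (bigD1 i) //= leq_addr.
apply: (@leq_trans (2 ^ r)%N); first by rewrite ltnW // ltn_expl.
move: di; rewrite /dvdz /= abszX; apply: dvdn_leq.
by rewrite absz_gt0.
Qed.

Lemma norm1D m k : (norm1 (m + k) <= norm1 m + norm1 k)%N.
Proof.
rewrite /norm1 -big_split; apply: leq_sum => i _ /=.
by rewrite mxE -lez_nat PoszD !abszE ler_normD.
Qed.

Lemma rapid_shift k c : rapid c -> rapid (fun m => c (m + k)).
Proof.
move=> hc B B0; have B1 : 0 <= 1 + B by rewrite addr_ge0.
have [M hM] := hc _ B1; exists (M * (1 + B) ^+ norm1 k) => m.
apply: le_trans (_ : cmod (c (m + k)) * (1 + B) ^+ norm1 (m + k)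
   * (1 + B) ^+ norm1 k <= _); last by rewrite ler_wpM2r ?exprn_ge0.
rewrite -mulrA ler_wpM2l ?cmod_ge0 // -exprD.
apply: (@le_trans _ _ ((1 + B) ^+ norm1 m)).
  by rewrite lerXn2r ?nnegrE // lerDr.
rewrite ler_weXn2l ?lerDl //; have := norm1D (m + k) (- k).
rewrite addrK (_ : norm1 (- k) = norm1 k) //.
by rewrite /norm1; apply: eq_bigr => i _; rewrite mxE abszN.
Qed.

Lemma fourier_shift k c z : rapid c ->
  fourier (fun m => c (m + k)) z = expdot (- k) z * fourier c z.
Proof.
move=> hc; have := has_sumZ (expdot (- k) z)
  (has_sum_reindex (addrK k) (subrK k) (fourier_has_sum z hc)).
apply: has_sum_unique; move: (fourier_has_sum z (rapid_shift k hc)).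
congr has_sum; apply: funext => m /=.
have -> : expdot m z = expdot (m + k) z * expdot (- k) z.
  by rewrite -expdotDl addrK.
ring.
Qed.

(** Multiplication by a character moves the coefficient at m to 0. *)
Lemma fourier_inj0 c : rapid c -> (forall z, fourier c z = 0) -> forall m, c m = 0.
Proof.
move=> hc c0 m; have := @fourier_eq0_coef0 (fun n => c (n + m)).
rewrite add0r; apply; first exact: rapid_shift.
by move=> z; rewrite fourier_shift // c0 mulr0.
Qed.

End FourierUniqueness.

(** * Positivity of Im tau and Gaussian decay of theta coefficients *)

Section GaussianDecay.
Variable R : realType.
Variable tau : 'M[C R]_3.
Hypothesis tau_siegel : siegel tau.
Local Notation lat := 'cV[int]_3.
Implicit Types m k : lat.

Definition quad m : C R := ((intv R m)^T *m tau *m intv R m) 0 0.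

Local Notation Y := (map_mx (fun w : C R => complex.Im w) tau).

Lemma ImD (x y : C R) : complex.Im (x + y) = complex.Im x + complex.Im y.
Proof. by case: x y => [? ?] [? ?]. Qed.

Lemma Im_quad m :
  complex.Im (quad m) = ((map_mx intr m : 'cV[R]_3)^T *m Y *m map_mx intr m) 0 0.
Proof.
rewrite /quad !mxE (big_morph (@complex.Im R) ImD (erefl : complex.Im (0 : C R) = 0)).
apply: eq_bigr => j _; rewrite !mxE !mulr_suml.
rewrite (big_morph (@complex.Im R) ImD (erefl : complex.Im (0 : C R) = 0)).
apply: eq_bigr => i _; rewrite !mxE.
have E (a : int) : (a%:~R : C R) = (a%:~R : R)%:C by rewrite rmorph_int.
rewrite !E; case: (tau i j) => x y /=.
by rewrite !mul0r !mulr0 !addr0 !add0r.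
Qed.

(** By homogeneity the form is bounded below by its minimum on the unit sphere of the maximum norm,
    attained by compactness. The 9 comes from comparing norms: [norm1] is at most three times the
    maximum norm. *)
Lemma siegel_coercive : exists2 l : R, 0 < l &
  forall m, l * (norm1 m)%:R ^+ 2 <= complex.Im (quad m).
Proof.
pose f (v : 'rV[R]_3) := (v *m Y *m v^T) 0 0.
have contf : continuous f.
  move=> v; apply: differentiable_continuous.
  rewrite (_ : f = \sum_(j < 3) (fun v : 'rV[R]_3 =>
     (\sum_(i < 3) (fun v : 'rV[R]_3 => v 0 i * Y i j)) v * v 0 j)).
    apply: differentiable_sum => j; apply: differentiableM; last first.
      exact: differentiable_coord.
    apply: differentiable_sum => i; apply: differentiableM; last first.
      exact: differentiable_cst.
    exact: differentiable_coord.
  apply: funext => {}v; rewrite /f mxE fct_sumE; apply: eq_bigr => j _.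
  by rewrite mxE fct_sumE [v^T _ _]mxE.
have fpos (v : 'rV[R]_3) : v != 0 -> 0 < f v.
  move=> v0; have [_ /(_ v^T)] := tau_siegel.
  by rewrite /f trmxK; apply; rewrite trmx_eq0.
have fZ (a : R) v : f (a *: v) = a ^+ 2 * f v.
  by rewrite /f linearZ /= -scalemxAr -!scalemxAl !mxE mulrA -expr2.
pose S : set 'rV[R]_3 := [set v | `|v| = 1].
have S0 : S !=set0.
  have n0 : (const_mx 1 : 'rV[R]_3) != 0.
    by apply/eqP => /rowP/(_ 0) /eqP; rewrite !mxE oner_eq0.
  exists (`|const_mx 1 : 'rV[R]_3|^-1 *: const_mx 1).
  by rewrite /S /= normrZ normfV normr_id mulVf // normr_eq0.
have cS : compact S.
  apply: bounded_closed_compact.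
    by exists 1; split => // x x1 v /= ->; exact: ltW.
  apply: (@closed_comp _ _ (fun v : 'rV[R]_3 => `|v|) [set x | x = 1]).
    by move=> v _; exact: norm_continuous.
  exact: closed_eq.
have [v0 v0S minf] := EVT_min_rV S0 cS (continuous_subspaceT contf).
have l0 : 0 < f v0.
  apply: fpos; apply/eqP => v00; move: v0S; rewrite inE /S /= v00 normr0 => /eqP.
  by rewrite eq_sym oner_eq0.
exists (f v0 / 9) => [|m]; first by rewrite divr_gt0.
pose v : 'rV[R]_3 := (map_mx intr m)^T.
have -> : complex.Im (quad m) = f v by rewrite Im_quad /f trmxK.
have [vz|vn] := eqVneq v 0.
  have -> : norm1 m = 0%N.
    rewrite /norm1 big1 // => i _; move/rowP/(_ i): vz; rewrite !mxE => /eqP.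
    by rewrite intr_eq0 => /eqP ->.
  by rewrite vz expr0n mulr0 /f mul0mx mul0mx mxE.
have nv : 0 < `|v| by rewrite normr_gt0.
have h1 : f v0 * `|v| ^+ 2 <= f v.
  have := minf (`|v|^-1 *: v); rewrite fZ => h.
  rewrite -ler_pdivlMr ?exprn_gt0 // mulrC -exprVn; apply: h.
  by rewrite inE /S /= normrZ normfV normr_id mulVf // gt_eqF.
apply: le_trans h1; rewrite -mulrA ler_wpM2l ?(ltW l0) //.
rewrite -ler_pdivlMl ?invr_gt0 // invrK (_ : 9 = 3 ^+ 2); last by ring.
rewrite -exprMn lerXn2r ?nnegrE ?mulr_ge0 //.
rewrite /norm1 natr_sum (_ : 3 * `|v| = \sum_(i < 3) `|v|).
  apply: ler_sum => i _; have := mx_entry_le v 0 i.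
  by rewrite !mxE -intr_norm -[in X in X -> _]abszE.
by rewrite sumr_const card_ord mulr_natl.
Qed.

(** The coefficients of the theta series of tau / N; N = 1 gives [theta]. *)
Definition gauss (N : nat) m : C R := cexp (piI R / N%:R * quad m).

Lemma cmod_gauss N m :
  cmod (gauss N m) = expR (- (pi / N%:R * complex.Im (quad m))).
Proof.
rewrite cmod_cexp; congr expR; case: (quad m) => x y /=.
rewrite (_ : piI R / N%:R = 0 +i* (pi / N%:R)) /=; first by rewrite mul0r add0r.
rewrite (_ : N%:R^-1 = (N%:R^-1)%:C); last by rewrite fmorphV rmorph_nat.
by rewrite /piI; apply/eqP; rewrite eq_complex /= !mul0r !mulr0 subr0 add0r !eqxx.
Qed.

Lemma rapid_gauss N : (0 < N)%N -> rapid (gauss N).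
Proof.
move=> N0 B B0; have [l l0 hl] := siegel_coercive.
pose a := pi / N%:R * l; have a0 : 0 < a.
  by rewrite !mulr_gt0 ?invr_gt0 ?ltr0n // pi_gt0.
(* The maximum of exp (B n - a n^2) over real n, found by completing the square; B^n is at most exp
   (B n). *)
exists (expR (B ^+ 2 / (4 * a))) => m.
apply: (@le_trans _ _ (expR (- (a * (norm1 m)%:R ^+ 2)) * expR (B * (norm1 m)%:R))).
  apply: ler_pM; rewrite ?cmod_ge0 ?exprn_ge0 //.
    rewrite cmod_gauss ler_expR lerN2 /a -mulrA ler_wpM2l //.
    by rewrite divr_ge0 // pi_ge0.
  rewrite expRM_natr lerXn2r ?nnegrE ?expR_ge0 //.
  by apply: le_trans (expR_ge1Dx B); rewrite lerDr.
rewrite -expRD ler_expR; set n : R := (norm1 m)%:R.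
rewrite ler_pdivlMr; last by rewrite mulr_gt0.
rewrite -subr_ge0.
rewrite (_ : _ - _ = (B - 2 * a * n) ^+ 2); first exact: sqr_ge0.
by ring.
Qed.

End GaussianDecay.

Lemma form_add (K : comNzRingType) (n : nat) (A : 'M[K]_n) (x y : 'cV[K]_n) :
  A^T = A -> ((x + y)^T *m A *m (x + y)) 0 0
  = (x^T *m A *m x) 0 0 + (y^T *m A *m y) 0 0 + 2 * (x^T *m (A *m y)) 0 0.
Proof.
move=> symA; have sym : (y^T *m A *m x) 0 0 = (x^T *m A *m y) 0 0.
  transitivity ((y^T *m A *m x)^T 0 0); first by rewrite [RHS]mxE.
  by rewrite !trmx_mul trmxK symA mulmxA.
have addE (B D : 'M[K]_1) : (B + D) 0 0 = B 0 0 + D 0 0 by rewrite mxE.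
rewrite mulmxDr [(_ + _)^T]linearD /= !mulmxDl !addE sym mulmxA.
set p := fun_of_matrix _ _ _; set q := fun_of_matrix _ _ _.
set r := fun_of_matrix _ _ _.
by rewrite mulr_natl mulr2n addrACA [q + r]addrC addrACA.
Qed.

(** * Multi-indices and small determinants *)

Section Exponents.
Implicit Types (i : 'I_3) (m : nat * nat * nat).

Definition incr (i : 'I_3) m : nat * nat * nat :=
  (m.1.1 + (i == i1), m.1.2 + (i == i2), m.2 + (i == i3))%N.

Lemma incr1 a b c : incr i1 (a, b, c) = (a.+1, b, c).
Proof. by rewrite /incr /= addn1 !addn0. Qed.

Lemma incr2 a b c : incr i2 (a, b, c) = (a, b.+1, c).
Proof. by rewrite /incr /= addn1 !addn0. Qed.

Lemma incr3 a b c : incr i3 (a, b, c) = (a, b, c.+1).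
Proof. by rewrite /incr /= addn1 !addn0. Qed.

Lemma ord3_ind (P : 'I_3 -> Prop) : P i1 -> P i2 -> P i3 -> forall i, P i.
Proof.
move=> p1 p2 p3 [[|[|[|//]]] lti].
- by rewrite (_ : Ordinal lti = i1) //; exact: val_inj.
- by rewrite (_ : Ordinal lti = i2) //; exact: val_inj.
- by rewrite (_ : Ordinal lti = i3) //; exact: val_inj.
Qed.

Definition weight m : nat := (m.1.1 + m.1.2 + m.2)%N.

Lemma weight_incr i m : weight (incr i m) = (weight m).+1.
Proof.
case: m => [[a b] c]; rewrite /weight /incr /=.
by case: i => [[|[|[|//]]]] lti; rewrite -!val_eqE /=; lia.
Qed.

End Exponents.

Lemma det_mx2 (K : comNzRingType) (M : 'M[K]_2) :
  \det M = M 0 0 * M 1 1 - M 0 1 * M 1 0.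
Proof.
rewrite (expand_det_row _ 0) !big_ord_recl big_ord0 /cofactor !det_mx11 !mxE /=.
rewrite expr0 mul1r expr1 mulN1r addr0 mulrN.
by congr (_ * M _ _ - M _ _ * M _ _); apply: val_inj.
Qed.

Lemma det_mx3 (K : comNzRingType) (M : 'M[K]_3) :
  \det M = M i1 i1 * (M i2 i2 * M i3 i3 - M i2 i3 * M i3 i2)
         - M i1 i2 * (M i2 i1 * M i3 i3 - M i2 i3 * M i3 i1)
         + M i1 i3 * (M i2 i1 * M i3 i2 - M i2 i2 * M i3 i1).
Proof.
rewrite (expand_det_row _ i1) !big_ord_recl big_ord0 /cofactor !det_mx2 !mxE /=.
have e1 : ord0 = i1 by apply: val_inj.
have e2 : lift ord0 ord0 = i2 by apply: val_inj.
have e3 : lift ord0 (lift ord0 ord0) = i3 by apply: val_inj.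
rewrite e3 e2 e1.
have l10 : lift i1 (0 : 'I_2) = i2 by apply: val_inj.
have l11 : lift i1 (1 : 'I_2) = i3 by apply: val_inj.
have l20 : lift i2 (0 : 'I_2) = i1 by apply: val_inj.
have l21 : lift i2 (1 : 'I_2) = i3 by apply: val_inj.
have l30 : lift i3 (0 : 'I_2) = i1 by apply: val_inj.
have l31 : lift i3 (1 : 'I_2) = i2 by apply: val_inj.
rewrite l10 l11 l20 l21 l30 l31 /=.
by ring.
Qed.

(** * Cardinalities of the families *)

Section Counting.

Lemma mem_exps3 n k m : (m \in exps3 n k) = (weight m + k == n)%N.
Proof.
case: m => [[a b] c]; rewrite mem_filter /weight; case: eqP => [h|//]; rewrite /= in h; rewrite andTb.
apply/allpairsPdep; exists (a, b), c; split=> //; last by rewrite mem_iota; lia.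
by apply/allpairsPdep; exists a, b; split=> //; rewrite mem_iota; lia.
Qed.

Lemma mem_exps2 n k m : (m \in exps2 n k) = (m.2 == 0%N) && (weight m + k == n)%N.
Proof. by rewrite mem_filter mem_exps3. Qed.

Lemma uniq_exps3 n k : uniq (exps3 n k).
Proof.
apply/filter_uniq/allpairs_uniq; rewrite ?iota_uniq //; last by move=> [? ?] [? ?].
by apply: allpairs_uniq; rewrite ?iota_uniq // => - [? ?] [? ?].
Qed.

(** A triple of sum j is determined by s = a + b <= j and a <= s, which gives (j+1)(j+2)/2
    choices. *)
Lemma size_exps3 j k : (2 * size (exps3 (j + k) k) <= j.+1 * j.+2)%N.
Proof.
pose E := [seq (a, s - a, j - s)%N | s <- iota 0 j.+1, a <- iota 0 s.+1].
have sE : (size (exps3 (j + k) k) <= size E)%N.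
  apply: uniq_leq_size; first exact: uniq_exps3.
  move=> [[a b] c]; rewrite mem_exps3 /weight /= eqn_add2r => /eqP h.
  apply/allpairsPdep; exists (a + b)%N, a; rewrite !mem_iota; split; try lia.
  by congr (_, _, _); lia.
apply: (@leq_trans (2 * size E)); first by rewrite leq_mul2l sE.
rewrite /E size_allpairs_dep {sE E}.
elim: j => // j IH; have -> : iota 0 j.+2 = iota 0 j.+1 ++ [:: j.+1].
  by rewrite -[j.+2]addn1 iotaD.
rewrite map_cat sumn_cat [sumn (map _ [:: _])]/= size_iota addn0; nia.
Qed.

Lemma size_exps2 j k : (size (exps2 (j + k) k) <= j.+1)%N.
Proof.
pose E := [seq (a, j - a, 0)%N | a <- iota 0 j.+1].
apply: (@leq_trans (size E)); last by rewrite size_map size_iota.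
apply: uniq_leq_size; first exact/filter_uniq/uniq_exps3.
move=> [[a b] c]; rewrite mem_exps2 /weight /= eqn_add2r => /andP[/eqP-> /eqP h].
apply/mapP; exists a; first by rewrite mem_iota; lia.
by congr (_, _, _); lia.
Qed.

Lemma exps3_nil n k : (n < k)%N -> exps3 n k = [::].
Proof.
move=> nk; case E: (exps3 n k) => [//|m s].
have : m \in exps3 n k by rewrite E mem_head.
by rewrite mem_exps3; lia.
Qed.

Lemma exps2_nil n k : (n < k)%N -> exps2 n k = [::].
Proof. by move=> nk; rewrite /exps2 exps3_nil. Qed.

Lemma size_cat_map9 (T U : Type) (f1 f2 f3 f4 f5 f6 f7 f8 f9 : T -> U)
    (s0 s2 t3 s3 s4 : seq T) :
  size (map f1 s0 ++ map f2 s2 ++ map f3 t3 ++ map f4 t3 ++ map f5 t3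
        ++ map f6 s3 ++ map f7 s3 ++ map f8 s3 ++ map f9 s4)
  = (size s0 + size s2 + 3 * size t3 + 3 * size s3 + size s4)%N.
Proof. by rewrite !size_cat !size_map; lia. Qed.

(** In degree d >= 4 the family sizes add up to 3d^2 - 3d + 1. Degrees 2 and 3 are separate because
    truncated subtraction breaks the counting formulas where a family is empty. *)
Lemma size_gr_family (R : realType) (tau : 'M[C R]_3) v n :
  (size (gr_family tau v n.+2) <= n.+2 ^ 3 - n.+1 ^ 3)%N.
Proof.
rewrite [size _](size_cat_map9 _ _ _ _ _ _ _ _ _ (exps3 n.+2 0)).
have e3 k : (k <= n.+2 -> 2 * size (exps3 n.+2 k) <= (n.+2 - k).+1 * (n.+2 - k).+2)%N.
  by move=> kn; have := size_exps3 (n.+2 - k) k; rewrite subnK.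
have e2 k : (k <= n.+2 -> size (exps2 n.+2 k) <= (n.+2 - k).+1)%N.
  by move=> kn; have := size_exps2 (n.+2 - k) k; rewrite subnK.
have := e3 0%N isT; have := e3 2%N isT; case: n e3 e2 => [|[|n]] e3 e2.
- by rewrite !(exps3_nil (k := 3)) // !(exps3_nil (k := 4)) // !(exps2_nil (k := 3)) //=; lia.
- have := e3 3%N isT; have := e2 3%N isT.
  by rewrite !(exps3_nil (k := 4)) //=; lia.
- have := e3 3%N isT; have := e2 3%N isT; have := e3 4%N isT.
  by rewrite !expnS !expn0; nia.
Qed.

End Counting.

(** * Membership by position in a list *)

Section Members.
Variables (T : Type) (x0 : T).

Definition listed (L : seq T) (f : T) := exists2 k, (k < size L)%N & f = nth x0 L k.

Lemma listed_cat L1 L2 f : listed (L1 ++ L2) f <-> listed L1 f \/ listed L2 f.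
Proof.
split=> [[k]|[[k kL ->]|[k kL ->]]].
- rewrite size_cat nth_cat => kL ->; case: ltnP => h; [by left; exists k | right].
  by exists (k - size L1)%N => //; lia.
- by exists k; rewrite ?size_cat ?nth_cat ?kL //; lia.
- exists (size L1 + k)%N; first by rewrite size_cat ltn_add2l.
  by rewrite nth_cat ltnNge leq_addr /= addKn.
Qed.

Lemma listed_map (S : eqType) (g : S -> T) (s : seq S) f :
  listed (map g s) f <-> exists2 m, m \in s & f = g m.
Proof.
split=> [[k]|[m ms ->]].
  rewrite size_map; case: s => // a s ks ->.
  by exists (nth a (a :: s) k); [exact: mem_nth | rewrite (nth_map a)].
exists (index m s); first by rewrite size_map index_mem.
by rewrite (nth_map m) ?index_mem // nth_index.
Qed.

Lemma listed_cat_map9 (S : eqType) (f1 f2 f3 f4 f5 f6 f7 f8 f9 : S -> T)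
    (s1 s2 s3 s4 s5 s6 s7 s8 s9 : seq S) f :
  listed (map f1 s1 ++ map f2 s2 ++ map f3 s3 ++ map f4 s4 ++ map f5 s5
       ++ map f6 s6 ++ map f7 s7 ++ map f8 s8 ++ map f9 s9) f <->
  (exists2 m, m \in s1 & f = f1 m) \/ (exists2 m, m \in s2 & f = f2 m) \/
  (exists2 m, m \in s3 & f = f3 m) \/ (exists2 m, m \in s4 & f = f4 m) \/
  (exists2 m, m \in s5 & f = f5 m) \/ (exists2 m, m \in s6 & f = f6 m) \/
  (exists2 m, m \in s7 & f = f7 m) \/ (exists2 m, m \in s8 & f = f8 m) \/
  (exists2 m, m \in s9 & f = f9 m).
Proof.
have catE L1 L2 : listed (L1 ++ L2) f = (listed L1 f \/ listed L2 f).
  exact/propext/listed_cat.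
have mapE (g : S -> T) s : listed (map g s) f = (exists2 m, m \in s & f = g m).
  exact/propext/listed_map.
by rewrite 8!catE 9!mapE.
Qed.

Lemma listed_nth L k : (k < size L)%N -> listed L (nth x0 L k). Proof. by exists k. Qed.

End Members.

(** * Theta functions of level N and their independence *)

Section NonsingularTheta.
Variable R : realType.
Variable tau : 'M[C R]_3.
Hypothesis tau_siegel : siegel tau.
Hypothesis Theta_ns : theta_nonsingular tau.
Local Notation vec := 'cV[C R]_3.
Local Notation lat := 'cV[int]_3.
Local Notation fn := (vec -> C R).
Local Notation theta := (theta tau).
Local Notation quad := (quad tau).
Local Notation gauss := (gauss tau).
Local Notation listed := (listed (0 : fn)).

Section ThetaFunctions.
Implicit Types (m a b : lat) (z : vec) (c : lat -> C R).

Lemma theta_fourier : theta = fourier (gauss 1).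
Proof.
apply: funext => z; rewrite /theta /fourier; congr sum; apply: funext => m.
by rewrite cexpD /gauss divr1.
Qed.

Lemma entire_theta : entire_ring theta.
Proof. by rewrite theta_fourier; apply/entire_fourier/rapid_gauss. Qed.

Lemma intvD m a : intv R (m + a) = intv R m + intv R a.
Proof. by rewrite /intv map_mxD. Qed.

Lemma quadD m a :
  quad (m + a) = quad m + quad a + 2 * dotz m (tau *m intv R a).
Proof. by rewrite /quad intvD (form_add _ _ tau_siegel.1). Qed.

Lemma intvMn m N : intv R (m *+ N) = N%:R *: intv R m.
Proof.
by apply/colP => i; rewrite !mxE mulmxnE rmorphMn /= mulr_natl.
Qed.

Lemma quadMn m N : quad (m *+ N) = N%:R ^+ 2 * quad m.
Proof.
rewrite /quad intvMn [(_ *: _)^T]linearZ /= -scalemxAr -!scalemxAl !mxE.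
by rewrite mulrA -expr2.
Qed.

Lemma dotz_int m a : exists q : int, dotz m (intv R a) = q%:~R.
Proof.
exists (\sum_i m i 0 * a i 0); rewrite dotzE rmorph_sum /=; apply: eq_bigr => i _.
by rewrite intrM mxE.
Qed.

Lemma expdot_int m a : expdot m (intv R a) = 1.
Proof. by rewrite /expdot; have [q ->] := dotz_int m a; exact: cexp_2piI_int. Qed.

Definition theta_mult b z : C R := cexp (- (piI R * quad b) - 2 * piI R * dotz b z).

(** What quasi-periodicity of weight N under tau Z^3 says about Fourier coefficients: those along a
    coset of N Z^3 determine one another. *)
Definition quasi_coef (N : nat) c := forall m b,
  c (m + b *+ N) = c m * expdot m (tau *m intv R b) * cexp (piI R * N%:R * quad b).

(** Replacing m by m + N b in the series at z turns it, term by term, into the series at the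
    translate, up to the automorphy factor. *)
Lemma fourier_quasi N c : rapid c -> quasi_coef N c -> forall a b z,
  fourier c (z + intv R a + tau *m intv R b) = theta_mult b z ^+ N * fourier c z.
Proof.
move=> hc qc a b z; set t := tau *m intv R b.
have h1 := fourier_has_sum (z + intv R a + t) hc.
apply: (has_sum_unique h1).
have := has_sumZ (theta_mult b z ^+ N)
  (has_sum_reindex (addrK (b *+ N)) (subrK (b *+ N)) (fourier_has_sum z hc)).
congr has_sum; apply: funext => m /=.
rewrite qc !expdotD expdot_int expdotDl mulr1 /theta_mult -cexpMn.
have E : cexp ((- (piI R * quad b) - 2 * piI R * dotz b z) *+ N)
    * cexp (piI R * N%:R * quad b) * expdot (b *+ N) z = 1.
  rewrite /expdot -!cexpD dotzMnl -(mulr_natl (_ - _) N) -(mulr_natl (dotz b z)).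
  move: (quad b) (dotz b z) (piI R) => p q P.
  by rewrite (_ : _ + _ = 0) ?cexp0 //; ring.
move: E (c m) (expdot m t) (expdot m z).
move: (cexp _) (cexp _) (expdot _ z) => e1 e2 e3 E x y w.
have aux (u1 u2 u3 v1 v2 v3 : C R) : u1 * u2 * u3 = 1 ->
    u1 * (v1 * v2 * u2 * (v3 * u3)) = v1 * (v3 * v2).
  move=> h; rewrite -[RHS]mulr1 -h; ring.
exact: aux.
Qed.

Lemma gauss_quasi N : (0 < N)%N -> quasi_coef N (gauss N).
Proof.
move=> N0 m b; rewrite /gauss quadD quadMn intvMn -scalemxAr dotzZ.
rewrite /expdot -!cexpD; congr cexp.
have : (N%:R : C R) != 0 by rewrite pnatr_eq0 -lt0n.
by move=> n0; field.
Qed.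

Lemma theta_quasi a b z :
  theta (z + intv R a + tau *m intv R b) = theta_mult b z * theta z.
Proof.
rewrite theta_fourier (@fourier_quasi 1) ?expr1 //; first exact: rapid_gauss.
exact: gauss_quasi.
Qed.

Lemma theta_mult_neq0 b z : theta_mult b z != 0.
Proof. exact: cexp_neq0. Qed.

Section Characteristics.
Variable N : nat.
Hypothesis N_gt0 : (0 < N)%N.
Implicit Types k : {ffun 'I_3 -> 'I_N}.

(** A class modulo N is invariant under m -> m + N b, so cutting the series down to it keeps the
    quasi-periodicity. The N^3 classes give N^3 theta functions of weight N, with disjoint
    supports. *)
Definition char_coef (k : {ffun 'I_3 -> 'I_N}) : lat -> C R := fun m =>
  if [forall i, (m i 0%R %% N)%Z == k i] then gauss N m else 0.

Definition theta_char (k : {ffun 'I_3 -> 'I_N}) : fn := fourier (char_coef k).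

Lemma rapid_char_coef k : rapid (char_coef k).
Proof. exact/rapid_if/rapid_gauss. Qed.

Lemma theta_char_quasi k a b z :
  theta_char k (z + intv R a + tau *m intv R b)
  = theta_mult b z ^+ N * theta_char k z.
Proof.
apply: fourier_quasi; first exact: rapid_char_coef.
move=> m d; rewrite /char_coef.
have -> : [forall i, ((m + d *+ N) i 0%R %% N)%Z == k i]
  = [forall i, (m i 0%R %% N)%Z == k i].
  apply: eq_forallb => i; rewrite mxE mulmxnE -mulr_natr.
  by rewrite natz addrC modzMDl.
by case: ifP => _; rewrite ?mul0r // gauss_quasi.
Qed.

Lemma theta_char_free (x : {ffun 'I_3 -> 'I_N} -> C R) :
  (forall z, \sum_k x k * theta_char k z = 0) -> forall k, x k = 0.
Proof.
move=> x0 k0.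
have hs (s : seq {ffun 'I_3 -> 'I_N}) :
   rapid (fun m => \sum_(k <- s) x k * char_coef k m).
  elim: s => [|k s IH].
    rewrite (_ : (fun _ => _) = fun=> 0); first exact: rapid0.
    by apply: funext => m; rewrite big_nil.
  rewrite (_ : (fun _ => _) =
     fun m => x k * char_coef k m + \sum_(k <- s) x k * char_coef k m).
    exact: (rapidD (rapidZ _ (rapid_char_coef k)) IH).
  by apply: funext => m; rewrite big_cons.
have c0 := fourier_inj0 (hs (index_enum _)) _ (\col_i (k0 i : nat)%:Z).
(* The lattice vector with coordinates [k0 i] lies in the support of [char_coef k0] only, so this
   coefficient isolates [x k0]. *)
have : \sum_k x k * char_coef k (\col_i (k0 i : nat)%:Z) = 0.
  apply: c0 => z; rewrite -[RHS](x0 z).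
  apply: (has_sum_unique (fourier_has_sum z (hs (index_enum _)))).
  have := has_sum_sum (index_enum {ffun 'I_3 -> 'I_N})
    (fun k => has_sumZ (x k) (fourier_has_sum z (rapid_char_coef k))).
  congr has_sum; apply: funext => m; rewrite mulr_suml.
  by apply: eq_bigr => k _; rewrite mulrA.
have mk i : ((k0 i : nat)%:Z %% N)%Z = k0 i by rewrite modz_nat modn_small.
rewrite (bigD1 k0) //= big1 => [|k kk0].
  rewrite addr0 /char_coef ifT; last by apply/forallP => i; rewrite mxE mk.
  by move=> /eqP; rewrite mulf_eq0 (negbTE (cexp_neq0 _)) orbF => /eqP.
rewrite /char_coef ifF ?mulr0 //; apply/negP => /forallP h.
move/eqP: kk0; apply; apply/ffunP => i; have := h i; rewrite mxE mk => /eqP.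
by move=> []/esym/val_inj.
Qed.

End Characteristics.

Lemma theta_near z : theta z != 0 -> \forall x \near z, theta x != 0.
Proof.
move=> z0.
have ct := differentiable_continuous (entire_ring_entire entire_theta z).
exact: (@cvgr_neq0 _ (C R) _ (nbhs z) _ theta _ ct z0).
Qed.

(* A singular point of Theta is the only obstruction to density of its complement. *)
Lemma theta_dense (G : fn) : (forall z, differentiable G z) ->
  (forall z, theta z != 0 -> G z = 0) -> forall z, G z = 0.
Proof.
move=> dG G0 z; apply/eqP/negPn/negP => Gz.
have near0 : \forall x \near z, theta x = 0.
  have : \forall x \near z, G x != 0.
    exact: (@cvgr_neq0 _ (C R) _ (nbhs z) _ G _ (differentiable_continuous (dG z)) Gz).
  apply: filterS => x Gx; apply/eqP/negPn/negP => tx.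
  by move: Gx; rewrite G0 // eqxx.
have [i0] := Theta_ns (nbhs_singleton near0); apply.
rewrite /partial (@near_eq_derive _ _ _ theta (fun=> 0)) //.
exact: derive_cst.
Qed.

End ThetaFunctions.

(** * Calculus of functions with poles on Theta, modulo their values on Theta *)

Definition eq_off (f g : fn) := forall z, theta z != 0 -> f z = g z.

Local Notation "f ~ g" := (eq_off f g) (at level 70).

Section PolesOnTheta.
Implicit Types (a b : lat) (z : vec) (f g h F G : fn) (i j k l : 'I_3).

Lemma eq_off_sym f g : f ~ g -> g ~ f. Proof. by move=> h z /h. Qed.
Lemma eq_off_trans g f h : f ~ g -> g ~ h -> f ~ h.
Proof. by move=> h1 h2 z z0; rewrite h1 // h2. Qed.

Lemma pd_near i f g z : (\forall x \near z, f x = g x) -> pd i f z = pd i g z.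
Proof. by move=> h; rewrite pdE /partial; exact: near_eq_derive. Qed.

Lemma near_off f g z : theta z != 0 -> f ~ g -> \forall x \near z, f x = g x.
Proof. by move=> z0 fg; apply: filterS (theta_near z0) => x /fg. Qed.

Lemma pd_off i f g : f ~ g -> pd i f ~ pd i g.
Proof. by move=> fg z z0; apply/pd_near/near_off. Qed.

Definition rep (n : nat) f F :=
  entire_ring F /\ forall z, theta z != 0 -> f z * theta z ^+ n = F z.

(** Periodicity is left out so that the logarithmic derivatives [dlog] are included, which are
    periodic only up to constants. *)
Definition mero f := exists n F, rep n f F.

Lemma rep_off n f F : rep n f F -> f ~ (fun z => F z / theta z ^+ n).
Proof. by move=> [_ h] z z0; rewrite -h // mulfK // expf_neq0. Qed.

Lemma rep_eq_off n f g F : rep n f F -> f ~ g -> rep n g F.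
Proof. by move=> [eF h] fg; split=> // z z0; rewrite -fg ?h. Qed.

Lemma mero_eq_off f g : mero f -> f ~ g -> mero g.
Proof. by move=> [n [F h]] fg; exists n, F; exact: rep_eq_off h fg. Qed.

Lemma eq_off_rep n f g F G : rep n f F -> rep n g G ->
  (forall z, theta z != 0 -> F z = G z) -> f ~ g.
Proof.
move=> [_ hf] [_ hg] FG z z0; apply: (mulIf (expf_neq0 n z0)).
by rewrite hf // hg // FG.
Qed.

Lemma rep_entire F : entire_ring F -> rep 0 F F.
Proof. by move=> eF; split=> // z _; rewrite expr0 mulr1. Qed.

Lemma rep_addn m n f F : rep n f F -> rep (n + m) f (fun z => F z * theta z ^+ m).
Proof.
move=> [eF h]; split=> [|z z0]; last by rewrite exprD mulrA h.
exact/entireM/entireX/entire_theta.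
Qed.

Lemma repD n f g F G : rep n f F -> rep n g G ->
  rep n (fun z => f z + g z) (fun z => F z + G z).
Proof.
move=> [eF hf] [eG hg]; split=> [|z z0]; first exact: entireD.
by rewrite mulrDl hf // hg.
Qed.

Lemma repM m n f g F G : rep m f F -> rep n g G ->
  rep (m + n) (fun z => f z * g z) (fun z => F z * G z).
Proof.
move=> [eF hf] [eG hg]; split=> [|z z0]; first exact: entireM.
by rewrite exprD mulrACA hf // hg.
Qed.

Lemma mero_cst (a : C R) : mero (fun=> a).
Proof. by exists 0, (fun=> a); apply/rep_entire/entire_cst. Qed.

Lemma meroM f g : mero f -> mero g -> mero (fun z => f z * g z).
Proof. by move=> [m [F hF]] [n [G hG]]; exists (m + n)%N, (fun z => F z * G z); exact: repM. Qed.

Lemma meroD f g : mero f -> mero g -> mero (fun z => f z + g z).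
Proof.
move=> [m [F hF]] [n [G hG]]; exists (m + n)%N, (fun z => F z * theta z ^+ n + G z * theta z ^+ m).
apply: repD; first exact: rep_addn hF.
by rewrite addnC; exact: rep_addn hG.
Qed.

Lemma mero_near f z : mero f -> theta z != 0 ->
  exists2 q : fn, differentiable q z & \forall x \near z, f x = q x.
Proof.
move=> [n [F hF]] z0; exists (fun x => F x / theta x ^+ n).
  have := @differentiableV _ _ (fun x => theta x ^+ n) z.
  move/(_ (entire_ring_entire (entireX n (entire_theta)) z)).
  rewrite expf_neq0 // => /(_ isT) d2.
  exact: (differentiableM (entire_ring_entire hF.1 z) d2).
exact/near_off/rep_off.
Qed.

Lemma pd_offD i f g : mero f -> mero g ->
  pd i (fun z => f z + g z) ~ (fun z => pd i f z + pd i g z).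
Proof.
move=> mf mg z z0; have [p dp np] := mero_near mf z0; have [q dq nq] := mero_near mg z0.
rewrite (pd_near i np) (pd_near i nq) -pdD //; apply: pd_near.
by near=> x; rewrite (near np x) // (near nq x).
Unshelve. all: by end_near. Qed.

Lemma pd_offM i f g : mero f -> mero g ->
  pd i (fun z => f z * g z) ~ (fun z => pd i f z * g z + f z * pd i g z).
Proof.
move=> mf mg z z0; have [p dp np] := mero_near mf z0; have [q dq nq] := mero_near mg z0.
rewrite (pd_near i np) (pd_near i nq) (nbhs_singleton np) (nbhs_singleton nq).
rewrite -pdM //; apply: pd_near.
by near=> x; rewrite (near np x) // (near nq x).
Unshelve. all: by end_near. Qed.

Lemma pd_offZ i (a : C R) f : mero f -> pd i (fun z => a * f z) ~ (fun z => a * pd i f z).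
Proof.
move=> mf; apply: eq_off_trans (pd_offM _ (mero_cst a) mf) _ => z _.
by rewrite pd_cst mul0r add0r.
Qed.

Lemma pd_offB i f g : mero f -> mero g ->
  pd i (fun z => f z - g z) ~ (fun z => pd i f z - pd i g z).
Proof.
move=> mf mg; have mg' := meroM (mero_cst (-1)) mg.
apply: (@eq_off_trans (pd i (fun z => f z + -1 * g z))).
  by apply: pd_off => z _; rewrite mulN1r.
apply: eq_off_trans (pd_offD _ mf mg') _ => z z0.
by rewrite pd_offZ // mulN1r.
Qed.

(** Multiplied through by theta, which avoids the exponent n - 1 in the power rule. *)
Lemma pd_X i n z : pd i (fun x => theta x ^+ n) z * theta z
  = n%:R * theta z ^+ n * pd i theta z.
Proof.
have dt := entire_ring_entire (entire_theta) z.
elim: n => [|n IH].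
  have E : (fun x => theta x ^+ 0) = (fun=> 1) by apply: funext => x; rewrite expr0.
  by rewrite E pd_cst !mul0r.
have E : (fun x => theta x ^+ n.+1) = (fun x => theta x * theta x ^+ n).
  by apply: funext => x; rewrite exprS.
rewrite E pdM //; last exact: (entire_ring_entire (entireX n (entire_theta))).
by rewrite mulrDl -[X in _ + X]mulrA IH exprS -natr1; ring.
Qed.

Lemma rep_pd i n f F : rep n f F ->
  rep n.+1 (pd i f) (fun z => pd i F z * theta z - n%:R * (F z * pd i theta z)).
Proof.
move=> hF; have [eF hf] := hF; have et := entire_theta; split.
  apply: entireB; first by apply: entireM => //; exact: entire_ring_pd.
  apply: entireM; first exact: entire_cst.
  by apply: entireM => //; exact: entire_ring_pd.
move=> z z0; rewrite (pd_off i (rep_off hF)) //.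
have n0 : theta z ^+ n != 0 by rewrite expf_neq0.
have dX := entire_ring_entire (entireX n et) z.
rewrite pdM; [|exact: (entire_ring_entire eF)|exact: (differentiableV dX n0)].
rewrite pdV //; have := pd_X i n z.
set p := pd i (fun x => _) z => hp.
have {}hp : p = n%:R * theta z ^+ n * pd i theta z / theta z by rewrite -hp mulfK.
have aux (u v t w q r : C R) : t != 0 -> w != 0 ->
    (u / w + v * (- (r * w * q / t) / w ^+ 2)) * (t * w) = u * t - r * (v * q).
  by move=> t0 w0; field; rewrite t0 w0.
by rewrite hp [theta z ^+ n.+1]exprS; exact: aux.
Qed.

Lemma mero_pd i f : mero f -> mero (pd i f).
Proof. by move=> [n [F /(rep_pd i) h]]; exists n.+1; eexists; exact: h. Qed.

(** Both sides have explicit numerators over theta^(n+2), which agree because partial derivatives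
    commute in [entire_ring]. *)
Lemma pd_offC i j f : mero f -> pd i (pd j f) ~ pd j (pd i f).
Proof.
move=> [n [F hF]]; have et := entire_theta.
have := rep_pd i (rep_pd j hF); have := rep_pd j (rep_pd i hF).
set G1 := (fun z => _ - _); set G2 := (fun z => _ - _) => h1 h2.
apply: eq_off_rep h2 h1 _ => z z0; rewrite /G1 /G2.
have eF := hF.1.
have E k l : pd k (fun z => pd l F z * theta z - n%:R * (F z * pd l theta z)) z
  = pd k (pd l F) z * theta z + pd l F z * pd k theta z
    - n%:R * (pd k F z * pd l theta z + F z * pd k (pd l theta) z).
  have d (h : fn) : entire_ring h -> differentiable h z.
    by move=> eh; exact: entire_ring_entire.
  have ep h m : entire_ring h -> entire_ring (pd m h) by exact: entire_ring_pd.
  have e1 : entire_ring (fun z => pd l F z * theta z) by apply: entireM => //; exact: ep.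
  have e2 : entire_ring (fun z => F z * pd l theta z) by apply: entireM => //; exact: ep.
  rewrite (_ : (fun z => _ - _) = (fun z => pd l F z * theta z
     + - n%:R * (F z * pd l theta z))); last by apply: funext => x; rewrite mulNr.
  rewrite (pdD k (d _ e1) (d _ (entireM (entire_cst (- n%:R)) e2))).
  rewrite (pdZ k _ (d _ e2)) (pdM k (d _ (ep _ _ eF)) (d _ et)).
  by rewrite (pdM k (d _ eF) (d _ (ep _ _ et))) mulNr.
by rewrite !E (entire_ring_pdC i j eF) (entire_ring_pdC i j et); ring.
Qed.

Definition translate (w : vec) f : fn := fun x => f (x + w).

(** Compared on difference quotients, so no differentiability of f is involved. *)
Lemma pd_translate i w f z : pd i (translate w f) z = pd i f (z + w).
Proof.
rewrite pdE /partial /derive; congr (lim (_ @ 0^')).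
by apply: funext => h; rewrite /translate /= addrA.
Qed.

Lemma pd_addcst i (a : C R) f z : pd i (fun x => f x + a) z = pd i f z.
Proof.
rewrite pdE /partial /derive; congr (lim (_ @ 0^')).
by apply: funext => h /=; rewrite opprD addrACA subrr addr0.
Qed.

Definition per a b : vec := intv R a + tau *m intv R b.

Lemma theta_per a b z : theta (z + per a b) = theta_mult b z * theta z.
Proof. by rewrite /per addrA theta_quasi. Qed.

Lemma theta_per_neq0 a b z : theta z != 0 -> theta (z + per a b) != 0.
Proof. by move=> z0; rewrite theta_per mulf_neq0 // theta_mult_neq0. Qed.

(** The constant k is there for [dlog]: periods that are additive constants disappear after one
    derivation. *)
Lemma pd_per i f a b (k : C R) :
  (forall z, theta z != 0 -> f (z + per a b) = f z + k) ->
  forall z, theta z != 0 -> pd i f (z + per a b) = pd i f z.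
Proof.
move=> hf z z0; rewrite -pd_translate -(pd_addcst i k f).
by apply: pd_near; apply: near_off => // x; exact: hf.
Qed.

Definition periodic f := forall a b z, theta z != 0 -> f (z + per a b) = f z.

(** A version of [A n] with numerator in [entire_ring], hence mapped by every derivation to
    [pole_le n.+1]. *)
Definition pole_le (n : nat) f := periodic f /\ exists F, rep n f F.

Lemma pole_le_A n f : pole_le n f -> A tau n%:Z f.
Proof.
move=> [pf [F [eF hF]]]; split; first by move=> a b z z0; rewrite -(pf a b z z0) /per addrA.
by exists F => //; exact: entire_ring_entire.
Qed.

Lemma pole_le_mero n f : pole_le n f -> mero f.
Proof. by move=> [_ [F h]]; exists n, F. Qed.

Lemma pole_le_off n f g : pole_le n f -> f ~ g -> pole_le n g.
Proof.
move=> [pf [F hF]] fg; split; last by exists F; exact: rep_eq_off fg.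
by move=> a b z z0; rewrite -!fg ?pf // theta_per_neq0.
Qed.

Lemma pole_le_leq m n f : (m <= n)%N -> pole_le m f -> pole_le n f.
Proof.
move=> mn [pf [F hF]]; split=> //; rewrite -(subnKC mn); eexists.
exact: rep_addn hF.
Qed.

Lemma pole_leD n f g : pole_le n f -> pole_le n g -> pole_le n (fun z => f z + g z).
Proof.
move=> [pf [F hF]] [pg [G hG]]; split; last by eexists; exact: repD hF hG.
by move=> a b z z0; rewrite pf // pg.
Qed.

Lemma pole_leM m n f g : pole_le m f -> pole_le n g ->
  pole_le (m + n) (fun z => f z * g z).
Proof.
move=> [pf [F hF]] [pg [G hG]]; split; last by eexists; exact: repM hF hG.
by move=> a b z z0; rewrite pf // pg.
Qed.

Lemma pole_le_cst (a : C R) : pole_le 0 (fun=> a).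
Proof. by split=> //; exists (fun=> a); apply/rep_entire/entire_cst. Qed.

Lemma pole_leZ n (a : C R) f : pole_le n f -> pole_le n (fun z => a * f z).
Proof. exact: (pole_leM (pole_le_cst a)). Qed.

Lemma pole_le_pd i n f : pole_le n f -> pole_le n.+1 (pd i f).
Proof.
move=> [pf [F hF]]; split; last by eexists; exact: rep_pd hF.
by move=> a b; apply: (@pd_per _ _ _ _ 0) => z z0; rewrite pf // addr0.
Qed.

Lemma pole_le_char N (chi : {ffun 'I_3 -> 'I_N}) : (0 < N)%N ->
  pole_le N (fun z => theta_char chi z / theta z ^+ N).
Proof.
move=> N0; split.
  move=> a b z z0; rewrite theta_per /per addrA theta_char_quasi // exprMn.
  rewrite -mulf_div divff ?mul1r // expf_neq0 //; exact: theta_mult_neq0.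
exists (theta_char chi); split.
  exact/entire_fourier/rapid_char_coef.
by move=> z z0; rewrite divfK // expf_neq0.
Qed.

Definition dlog i : fn := fun z => pd i theta z / theta z.

Lemma rep_dlog i : rep 1 (dlog i) (pd i theta).
Proof.
split; first by apply: entire_ring_pd; exact: entire_theta.
by move=> z z0; rewrite expr1 divfK.
Qed.

Lemma mero_dlog i : mero (dlog i). Proof. by exists 1, (pd i theta); exact: rep_dlog. Qed.

(** An exponential is a one-term Fourier series; this puts the automorphy factor [theta_mult b] into
    [entire_ring]. *)
Lemma fourier_delta b (a : C R) :
  rapid (fun m => if m == b then a else 0) /\
  fourier (fun m => if m == b then a else 0) = fun z => a * expdot b z.
Proof.
have hr : rapid (fun m : lat => if m == b then a else 0).
  move=> B B0; exists (cmod a * B ^+ norm1 b) => m.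
  case: eqP => [->//|_]; rewrite cmod0 mul0r.
  by rewrite mulr_ge0 ?cmod_ge0 // exprn_ge0.
split=> //; apply: funext => z; apply: (has_sum_unique (fourier_has_sum z hr)).
have := has_sum_delta b (a * expdot b z); congr has_sum.
by apply: funext => m; case: eqP => [->//|_]; rewrite mul0r.
Qed.

Lemma theta_multE b : exists2 c : C R, c != 0 &
  theta_mult b = fun z => c * expdot (- b) z.
Proof.
exists (cexp (- (piI R * quad b))); first exact: cexp_neq0.
apply: funext => z; rewrite /theta_mult /expdot -cexpD dotzNl; congr cexp; ring.
Qed.

Lemma entire_theta_mult b : entire_ring (theta_mult b).
Proof.
have [c _ ->] := theta_multE b; have [hr <-] := fourier_delta (- b) c.
exact: entire_fourier.
Qed.

Lemma pd_theta_mult b i z : pd i (theta_mult b) z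
  = - (2 * piI R * (b i 0)%:~R) * theta_mult b z.
Proof.
have [c _ E] := theta_multE b; have [hr F1] := fourier_delta (- b) c.
pose K := - (2 * piI R * (b i 0)%:~R); have [_ F2] := fourier_delta (- b) (K * c).
have D : dcoef i (fun m => if m == - b then c else 0)
    = fun m => if m == - b then K * c else 0.
  apply: funext => m; rewrite /dcoef; case: eqP => [->|_]; last by rewrite mulr0.
  by rewrite mxE intrN mulrN.
by rewrite E -{1}F1 pd_fourier // D F2 -/K mulrA.
Qed.

Lemma dlog_per i a b z : theta z != 0 ->
  dlog i (z + per a b) = dlog i z + - (2 * piI R * (b i 0)%:~R).
Proof.
move=> z0; have m0 := theta_mult_neq0 b z.
rewrite /dlog theta_per -pd_translate.
rewrite (_ : translate _ _ = fun x => theta_mult b x * theta x); last first.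
  by apply: funext => x; rewrite /translate theta_per.
rewrite pdM; [|exact: (entire_ring_entire (entire_theta_mult b))
  |exact: (entire_ring_entire (entire_theta))].
by rewrite pd_theta_mult; field; rewrite m0 z0.
Qed.

Lemma pole_le_pd_dlog i j : pole_le 2 (pd i (dlog j)).
Proof.
split; last by eexists; exact: (rep_pd i (rep_dlog j)).
by move=> a b z z0; apply: pd_per z0 => x; exact: dlog_per.
Qed.

Lemma pd_dlogC i j : pd i (dlog j) ~ pd j (dlog i).
Proof.
apply: (eq_off_rep (rep_pd i (rep_dlog j)) (rep_pd j (rep_dlog i))) => z z0.
by rewrite (entire_ring_pdC i j (entire_theta)); ring.
Qed.

Lemma pd_dlogE i j z : theta z != 0 -> pd i (dlog j) z
  = (pd i (pd j theta) z * theta z - pd j theta z * pd i theta z) / theta z ^+ 2.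
Proof. by move=> z0; rewrite (rep_off (rep_pd i (rep_dlog j)) z0) mul1r. Qed.

End PolesOnTheta.

(** * Derivatives of log theta, minors of the zeta matrix and their pole orders *)

Section Generators.
Implicit Types (z : vec) (f g h : fn) (i j k l : 'I_3) (m : nat * nat * nat).

Lemma dlogthetaE j : dlogtheta tau j = dlog j.
Proof. by rewrite /dlogtheta /dlog pdE. Qed.

Lemma zetaE i j : zeta tau i j = pd i (dlog j).
Proof. by rewrite /zeta dlogthetaE pdE. Qed.

Definition minor2 i j k l : fn := zminor tau [tuple i; j] [tuple k; l].
Definition minor3 : fn := zminor tau [tuple i1; i2; i3] [tuple i1; i2; i3].

Lemma minor2E i j k l z : minor2 i j k l z
  = zeta tau i k z * zeta tau j l z - zeta tau i l z * zeta tau j k z.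
Proof. by rewrite /minor2 /zminor det_mx2 !mxE !(tnth_nth i). Qed.

Local Notation t i j z := (pd i (pd j theta) z).
Local Notation u i z := (pd i theta z).

Lemma zeta_quot i j z : theta z != 0 ->
  zeta tau i j z = (t i j z * theta z - u j z * u i z) / theta z ^+ 2.
Proof. by move=> z0; rewrite zetaE pd_dlogE. Qed.

Lemma pole_le_zeta i j : pole_le 2 (zeta tau i j).
Proof. by rewrite zetaE; exact: pole_le_pd_dlog. Qed.

Lemma pole_leB n f g : pole_le n f -> pole_le n g -> pole_le n (fun z => f z - g z).
Proof.
move=> pf /(pole_leZ (-1)) pg; apply: pole_le_off (pole_leD pf pg) _ => z _.
by rewrite mulN1r.
Qed.

Ltac entire_tac := repeat first
  [ apply: entireB | apply: entireD | apply: entireM | apply: entire_ring_pd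
  | exact: entire_theta ].

(* The leading terms of the [zeta]'s form a rank one matrix, so that minors have
   lower pole order than their degree suggests. *)
Lemma pole_le_minor2 i j k l : pole_le 3 (minor2 i j k l).
Proof.
split.
  have [h _] := pole_leB (pole_leM (pole_le_zeta i k) (pole_le_zeta j l))
    (pole_leM (pole_le_zeta i l) (pole_le_zeta j k)).
  by move=> a b z z0; rewrite !minor2E; exact: h.
exists (fun z => theta z * (t i k z * t j l z - t i l z * t j k z)
  - (t i k z * (u l z * u j z) + t j l z * (u k z * u i z))
  + (t i l z * (u k z * u j z) + t j k z * (u l z * u i z))).
split; first by entire_tac.
move=> z z0; rewrite minor2E !zeta_quot //.
move: (t i k z) (t j l z) (t i l z) (t j k z) (u i z) (u j z) (u k z) (u l z) (theta z) z0.
by move=> *; field.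
Qed.

Lemma minor3E z : minor3 z =
    zeta tau i1 i1 z * (zeta tau i2 i2 z * zeta tau i3 i3 z - zeta tau i2 i3 z * zeta tau i3 i2 z)
  - zeta tau i1 i2 z * (zeta tau i2 i1 z * zeta tau i3 i3 z - zeta tau i2 i3 z * zeta tau i3 i1 z)
  + zeta tau i1 i3 z * (zeta tau i2 i1 z * zeta tau i3 i2 z - zeta tau i2 i2 z * zeta tau i3 i1 z).
Proof. by rewrite /minor3 /zminor det_mx3 !mxE !(tnth_nth i1). Qed.

Lemma pole_le_minor3 : pole_le 4 minor3.
Proof.
have pz := pole_le_zeta.
split.
  have pm a b c d := pole_leB (pole_leM (pz a b) (pz c d)) (pole_leM (pz a d) (pz c b)).
  have [h _] := pole_leD (pole_leB
    (pole_leM (pz i1 i1) (pole_leB (pole_leM (pz i2 i2) (pz i3 i3)) (pole_leM (pz i2 i3) (pz i3 i2))))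
    (pole_leM (pz i1 i2) (pole_leB (pole_leM (pz i2 i1) (pz i3 i3)) (pole_leM (pz i2 i3) (pz i3 i1)))))
    (pole_leM (pz i1 i3) (pole_leB (pole_leM (pz i2 i1) (pz i3 i2)) (pole_leM (pz i2 i2) (pz i3 i1)))).
  by move=> a b z z0; rewrite !minor3E; exact: h.
(* With T the Hessian and u the gradient of theta, the determinant of theta T - u u^t is theta^3 det
   T - theta^2 u^t adj(T) u. Division by theta^6 leaves pole order 4 and the numerator below; [cof]
   gives the entries of adj(T) up to sign. *)
pose cof a b c d z := t a c z * t b d z - t a d z * t b c z.
exists (fun z => theta z * (t i1 i1 z * cof i2 i3 i2 i3 z - t i1 i2 z * cof i2 i3 i1 i3 z
    + t i1 i3 z * cof i2 i3 i1 i2 z)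
  - (u i1 z * (u i1 z * cof i2 i3 i2 i3 z - u i2 z * cof i2 i3 i1 i3 z + u i3 z * cof i2 i3 i1 i2 z)
   - u i2 z * (u i1 z * cof i1 i3 i2 i3 z - u i2 z * cof i1 i3 i1 i3 z + u i3 z * cof i1 i3 i1 i2 z)
   + u i3 z * (u i1 z * cof i1 i2 i2 i3 z - u i2 z * cof i1 i2 i1 i3 z + u i3 z * cof i1 i2 i1 i2 z))).
split; first by rewrite /cof; entire_tac.
move=> z z0; rewrite minor3E !zeta_quot // /cof.
move: (t i1 i1 z) (t i1 i2 z) (t i1 i3 z) (t i2 i1 z) (t i2 i2 z) (t i2 i3 z)
  (t i3 i1 z) (t i3 i2 z) (t i3 i3 z) (u i1 z) (u i2 z) (u i3 z) (theta z) z0.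
by move=> *; field.
Qed.

Lemma partialsE m f : partials m f =
  iter m.1.1 (pd i1) (iter m.1.2 (pd i2) (iter m.2 (pd i3) f)).
Proof. by rewrite pdE. Qed.

Lemma iter_pd_off i n f g : f ~ g -> iter n (pd i) f ~ iter n (pd i) g.
Proof. by move=> fg; elim: n => //= n; exact: pd_off. Qed.

Lemma mero_iter i n f : mero f -> mero (iter n (pd i) f).
Proof. by move=> mf; elim: n => //= n; exact: mero_pd. Qed.

Lemma iter_pdC i j n f : mero f -> iter n (pd i) (pd j f) ~ pd j (iter n (pd i) f).
Proof.
move=> mf; elim: n => //= n IH; apply: eq_off_trans (pd_off i IH) _.
exact/pd_offC/mero_iter.
Qed.

Lemma mero_partials m f : mero f -> mero (partials m f).
Proof. by move=> mf; rewrite partialsE; do 3 apply: mero_iter. Qed.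

Lemma partials_off m f g : f ~ g -> partials m f ~ partials m g.
Proof. by move=> fg; rewrite !partialsE; do 3 apply: iter_pd_off. Qed.

Lemma partials_pdC i m f : mero f -> partials m (pd i f) ~ pd i (partials m f).
Proof.
move=> mf; rewrite !partialsE.
apply: eq_off_trans (iter_pdC _ _ _ _); last by do 2 apply: mero_iter.
apply: iter_pd_off; apply: eq_off_trans (iter_pdC _ _ _ _); last exact: mero_iter.
exact/iter_pd_off/iter_pdC.
Qed.

Lemma partials_incr i m f : mero f -> partials m (pd i f) ~ partials (incr i m) f.
Proof.
case: m => [[a b] c] mf; move: i; apply: ord3_ind.
- apply: eq_off_trans (partials_pdC _ _ mf) _.
  by rewrite incr1 !partialsE.
- rewrite incr2 !partialsE; apply: iter_pd_off.
  by rewrite [in X in _ ~ X]/= -iterS iterSr; apply: iter_pd_off; exact: iter_pdC.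
- by rewrite incr3 !partialsE /= -iterS iterSr.
Qed.

Lemma pd_partials i m f : mero f -> pd i (partials m f) ~ partials (incr i m) f.
Proof.
move=> mf; apply: eq_off_trans (partials_incr i m mf).
exact/eq_off_sym/partials_pdC.
Qed.

Lemma partialsB m f g : mero f -> mero g ->
  partials m (fun z => f z - g z) ~ (fun z => partials m f z - partials m g z).
Proof.
have iterB i n f' g' : mero f' -> mero g' -> iter n (pd i) (fun z => f' z - g' z)
    ~ (fun z => iter n (pd i) f' z - iter n (pd i) g' z).
  move=> mf mg; elim: n => //= n IH.
  apply: eq_off_trans (pd_off i IH) _.
  by apply: pd_offB => //; exact: mero_iter.
move=> mf mg; rewrite !partialsE.
apply: eq_off_trans (iter_pd_off _ _ _) _; last first.
  by apply: (iterB i1); do 2 apply: mero_iter.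
apply: eq_off_trans (iter_pd_off _ _ _) _; last first.
  by apply: (iterB i2); apply: mero_iter.
exact: iterB.
Qed.

Lemma pole_le_partials n m f : pole_le n f -> pole_le (weight m + n) (partials m f).
Proof.
have shift i p n' f' : pole_le n' f' -> pole_le (p + n') (iter p (pd i) f').
    by move=> h; elim: p => [//|p IH]; exact: pole_le_pd IH.
case: m => [[a b] c] pf; rewrite partialsE /weight /= -!addnA.
exact: (shift i1 a _ _ (shift i2 b _ _ (shift i3 c _ _ pf))).
Qed.

Lemma logtheta3 a b c :
  partials_logtheta tau (a, b, c.+1) = partials (a, b, c) (dlog i3).
Proof. by rewrite -dlogthetaE; case: a b => [|a] [|b]. Qed.

Lemma logtheta2 a b :
  partials_logtheta tau (a, b.+1, 0%N) = partials (a, b, 0%N) (dlog i2).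
Proof. by rewrite -dlogthetaE; case: a. Qed.

Lemma logtheta1 a :
  partials_logtheta tau (a.+1, 0%N, 0%N) = partials (a, 0%N, 0%N) (dlog i1).
Proof. by rewrite -dlogthetaE. Qed.

(** [partials_logtheta] takes as innermost derivation the one of largest index present. If i is
    larger still, the innermost derivation changes, and the symmetry of the zeta matrix exchanges
    the two. *)
Lemma pd_logtheta i m : (0 < weight m)%N ->
  pd i (partials_logtheta tau m) ~ partials_logtheta tau (incr i m).
Proof.
have pC f k n g : mero g -> partials n (pd k g) ~ f -> pd k (partials n g) ~ f.
  by move=> mg; apply: eq_off_trans; exact/eq_off_sym/partials_pdC.
have md := mero_dlog.
case: m => [[a b] [|c]]; last first.
  move=> _; move: i; apply: ord3_ind; rewrite ?(incr1, incr2, incr3) ?(logtheta1, logtheta2, logtheta3).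
  - by rewrite -incr1; exact: pd_partials.
  - by rewrite -incr2; exact: pd_partials.
  - by rewrite -incr3; exact: pd_partials.
case: b => [|b]; last first.
  move=> _; move: i; apply: ord3_ind; rewrite ?(incr1, incr2, incr3) ?(logtheta1, logtheta2, logtheta3).
  - by rewrite -incr1; exact: pd_partials.
  - by rewrite -incr2; exact: pd_partials.
  - apply: (pC _ _ _ _ (md _)); apply: eq_off_trans (partials_off _ (pd_dlogC _ _)) _ => //.
    by rewrite -incr2; exact: partials_incr.
case: a => // a _; move: i; apply: ord3_ind; rewrite ?(incr1, incr2, incr3) ?(logtheta1, logtheta2, logtheta3).
- by rewrite -incr1; exact: pd_partials.
- apply: (pC _ _ _ _ (md _)); apply: eq_off_trans (partials_off _ (pd_dlogC _ _)) _ => //.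
  by rewrite -incr1; exact: partials_incr.
- apply: (pC _ _ _ _ (md _)); apply: eq_off_trans (partials_off _ (pd_dlogC _ _)) _ => //.
  by rewrite -incr1; exact: partials_incr.
Qed.

Lemma dlog_logtheta j : exists2 m, weight m = 1 & dlog j = partials_logtheta tau m.
Proof.
move: j; apply: ord3_ind.
- by exists (1, 0, 0)%N; rewrite //= dlogthetaE.
- by exists (0, 1, 0)%N; rewrite //= dlogthetaE.
- by exists (0, 0, 1)%N; rewrite //= dlogthetaE.
Qed.

Lemma zeta_logtheta i j :
  exists2 m, weight m = 2 & zeta tau i j ~ partials_logtheta tau m.
Proof.
have [m w E] := dlog_logtheta j; exists (incr i m); first by rewrite weight_incr w.
by rewrite zetaE E; apply: pd_logtheta; rewrite w.
Qed.

Lemma mero_logtheta m : (0 < weight m)%N -> mero (partials_logtheta tau m).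
Proof.
case: m => [[[|a] [|b]] [|c]] // _; rewrite /partials_logtheta dlogthetaE;
  exact/mero_partials/mero_dlog.
Qed.

(** Weight 2 is the start of the induction because a first derivative of log theta is not periodic;
    from there each derivation raises the order by one. *)
Lemma pole_le_logtheta m : (2 <= weight m)%N ->
  pole_le (weight m) (partials_logtheta tau m).
Proof.
have incr_ex m' : (0 < weight m')%N -> exists i n, m' = incr i n.
  case: m' => [[a b] [|c]]; last by exists i3, (a, b, c); rewrite incr3.
  case: b => [|b]; last by exists i2, (a, b, 0%N); rewrite incr2.
  by case: a => // a _; exists i1, (a, 0%N, 0%N); rewrite incr1.
have aux n : forall m', weight m' = n.+2 -> pole_le n.+2 (partials_logtheta tau m').
  elim: n => [|n IH] m' w'.
    have /incr_ex[i [m1 E]] : (0 < weight m')%N by rewrite w'.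
    have w1 : weight m1 = 1%N by move: w'; rewrite E weight_incr => -[].
    have /incr_ex[j [m2 E2]] : (0 < weight m1)%N by rewrite w1.
    have w2 : weight m2 = 0%N by move: w1; rewrite E2 weight_incr => -[].
    apply: pole_le_off (pole_le_pd_dlog i j) _.
    have [m3 w3 E3] := dlog_logtheta j.
    have -> : dlog j = partials_logtheta tau m1.
      rewrite E2; case: m2 w2 {E2} => [[[|//] [|//]] [|//]] _.
      by move: j {E3}; apply: ord3_ind; 
        rewrite ?(incr1, incr2, incr3) ?(logtheta1, logtheta2, logtheta3).
    by rewrite E; apply: pd_logtheta; rewrite w1.
  have /incr_ex[i [m1 E]] : (0 < weight m')%N by rewrite w'.
  have w1 : weight m1 = n.+2 by move: w'; rewrite E weight_incr => -[].
  apply: pole_le_off (pole_le_pd i (IH _ w1)) _.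
  by rewrite E; apply: pd_logtheta; rewrite w1.
case E: (weight m) => [|[|n]] // _; exact: aux.
Qed.

End Generators.

(** * Linear spans modulo functions vanishing off Theta, and comparison of dimensions *)

Section Spans.
Implicit Types (z : vec) (f g h : fn) (i : 'I_3) (m : nat * nat * nat).
Implicit Types (S : fn -> Prop) (L : seq fn).

Inductive span S : fn -> Prop :=
| span0 : span S (fun=> 0)
| span_cons (a : C R) f g : S f -> span S g -> span S (fun z => a * f z + g z)
| span_off f g : span S f -> f ~ g -> span S g.

Lemma span_mem S f : S f -> span S f.
Proof.
move=> Sf; apply: span_off (span_cons 1 Sf (span0 S)) _ => z _.
by rewrite mul1r addr0.
Qed.

Lemma spanD S f g : span S f -> span S g -> span S (fun z => f z + g z).
Proof.
move=> hf hg; elim: hf => [|a f1 f2 S1 _ IH|f1 f2 _ IH e].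
- by apply: span_off hg _ => z _; rewrite add0r.
- by apply: span_off (span_cons a S1 IH) _ => z _; rewrite addrA.
- by apply: span_off IH _ => z z0; rewrite e.
Qed.

Lemma spanZ S (a : C R) f : span S f -> span S (fun z => a * f z).
Proof.
elim=> [|b f1 f2 S1 _ IH|f1 f2 _ IH e].
- by apply: span_off (span0 S) _ => z _; rewrite mulr0.
- by apply: span_off (span_cons (a * b) S1 IH) _ => z _; rewrite mulrDr mulrA.
- by apply: span_off IH _ => z z0; rewrite e.
Qed.

Lemma spanB S f g : span S f -> span S g -> span S (fun z => f z - g z).
Proof.
move=> hf /(spanZ (-1)) hg; apply: span_off (spanD hf hg) _ => z _.
by rewrite mulN1r.
Qed.

Lemma span_sub S S' f : (forall g, S g -> span S' g) -> span S f -> span S' f.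
Proof.
move=> sub; elim=> [|a f1 f2 S1 _ IH|f1 f2 _ IH e].
- exact: span0.
- by apply: spanD IH; apply: spanZ; exact: sub.
- exact: span_off IH e.
Qed.

Lemma span_mero S f : (forall g, S g -> mero g) -> span S f -> mero f.
Proof.
move=> sub; elim=> [|a f1 f2 S1 _ IH|f1 f2 _ IH e].
- exact: mero_cst.
- by apply: meroD IH; apply: meroM; [exact: mero_cst | exact: sub].
- exact: mero_eq_off IH e.
Qed.

(** Derivations are additive only on functions known to be differentiable off Theta, which is why
    the members of S must be [mero]. *)
Lemma span_pd S S' i f : (forall g, S g -> mero g) ->
  (forall g, S g -> span S' (pd i g)) -> span S f -> span S' (pd i f).
Proof.
move=> mS pS; elim=> [|a f1 f2 S1 hf2 IH|f1 f2 _ IH e].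
- by apply: span_off (span0 _) _ => z _; rewrite pd_cst.
- have m1 := mS _ S1; have m2 := span_mero mS hf2.
  apply: span_off (spanD (spanZ a (pS _ S1)) IH) _.
  apply: eq_off_trans (eq_off_sym (pd_offD _ (meroM (mero_cst _) m1) m2)).
  by move=> z z0; rewrite pd_offZ.
- exact: span_off IH (pd_off i e).
Qed.

Lemma span_pole_le n S f : (forall g, S g -> pole_le n g) -> span S f -> pole_le n f.
Proof.
move=> sub; elim=> [|a f1 f2 S1 _ IH|f1 f2 _ IH e].
- by apply: pole_le_leq (pole_le_cst 0).
- by apply: pole_leD IH; apply: pole_leZ; exact: sub.
- exact: pole_le_off IH e.
Qed.

Definition lin (L : seq fn) (c : nat -> C R) : fn :=
  fun z => \sum_(k < size L) c k * nth 0 L k z.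

Lemma span_lin L f : span (listed L) f -> exists c, f ~ lin L c.
Proof.
elim=> [|a f1 f2 [p pL ->] _ [c IH]|f1 f2 _ [c IH] e].
- by exists (fun=> 0) => z _; rewrite /lin big1 // => k _; rewrite mul0r.
- exists (fun k => (if k == p then a else 0) + c k) => z z0; rewrite IH // /lin.
  rewrite [RHS](eq_bigr (fun k : 'I_(size L) => (if k == p :> nat then a else 0) * nth 0 L k z
    + c k * nth 0 L k z)); last by move=> k _ /=; rewrite mulrDl.
  rewrite big_split /=; congr (_ + _); rewrite (bigD1 (Ordinal pL)) //= eqxx big1 ?addr0 // => k kp.
  by rewrite ifF ?mul0r //; apply: contraNF kp => /eqP e; apply/eqP/val_inj.
- by exists c; apply: eq_off_trans IH; exact: eq_off_sym.
Qed.

Lemma lin_span L c : span (listed L) (lin L c).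
Proof.
rewrite /lin; have : forall r : seq 'I_(size L),
   span (listed L) (fun z => \sum_(k <- r) c k * nth 0 L k z).
  elim=> [|k r IH].
    by apply: span_off (span0 _) _ => z _; rewrite big_nil.
  apply: span_off (span_cons (c k) (listed_nth _ (ltn_ord k)) IH) _ => z _.
  by rewrite big_cons.
exact.
Qed.

Lemma lin_cat L1 L2 c z : lin (L1 ++ L2) c z
  = lin L1 c z + lin L2 (fun k => c (size L1 + k)%N) z.
Proof.
rewrite /lin size_cat big_split_ord /=; congr (_ + _); apply: eq_bigr => k _ /=.
  by rewrite nth_cat ltn_ord.
by rewrite nth_cat ltnNge leq_addr /= addKn.
Qed.

Definition free_off L := forall c, lin L c ~ (fun=> 0) ->
  forall k, (k < size L)%N -> c k = 0.

Section Dimension.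

(** A relation off Theta becomes, after multiplication by theta^N, one between entire functions; it
    extends over Theta by density. *)
Lemma char_quot_free N (x : {ffun 'I_3 -> 'I_N} -> C R) : (0 < N)%N ->
  (fun z => \sum_chi x chi * (theta_char chi z / theta z ^+ N)) ~ (fun=> 0) ->
  forall chi, x chi = 0.
Proof.
move=> N0 h; apply: theta_char_free => //.
apply: (theta_dense (G := fun z => \sum_chi x chi * theta_char chi z)).
  apply: entire_ring_entire; apply: entire_sum => chi; apply: entireM.
    exact: entire_cst.
  exact/entire_fourier/rapid_char_coef.
move=> z z0; have /eqP := h z z0; rewrite (eq_bigr (fun chi =>
  x chi * theta_char chi z / theta z ^+ N)); last by move=> *; rewrite mulrA.
by rewrite -mulr_suml mulf_eq0 invr_eq0 expf_eq0 (negbTE z0) andbF orbF => /eqP.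
Qed.

(** Let M express the N^3 independent quotients through L. Its rows are independent, and there are
    at least as many rows as columns, so M has a left inverse B. Then B expresses L through the
    quotients, which bounds the poles of L, and a relation y on L gives y B = 0, hence y = y B M =
    0. *)
Lemma spanning_list N L : (0 < N)%N -> (size L <= N ^ 3)%N ->
  (forall chi : {ffun 'I_3 -> 'I_N},
     span (listed L) (fun z => theta_char chi z / theta z ^+ N)) ->
  free_off L /\ forall f, listed L f -> pole_le N f.
Proof.
move=> N0 sL hL; pose K := #|{: {ffun 'I_3 -> 'I_N}}|.
have KE : K = (N ^ 3)%N by rewrite /K card_ffun !card_ord.
pose e (p : 'I_K) : fn := fun z => theta_char (enum_val p) z / theta z ^+ N.
have [M hM] : exists M : 'M[C R]_(K, size L),
    forall p, e p ~ (fun z => \sum_j M p j * nth 0 L j z).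
  have /choice[c hc] : forall p, exists c, e p ~ lin L c.
    by move=> p; apply/span_lin/hL.
  by exists (\matrix_(p, j) c p j) => p z z0; rewrite hc //; apply: eq_bigr => j _; rewrite mxE.
have e_free (x : 'rV_K) : (fun z => \sum_p x 0 p * e p z) ~ (fun=> 0) -> x = 0.
  move=> hx; have := @char_quot_free N (fun chi => x 0 (enum_rank chi)) N0 _.
  move=> h; apply/rowP => p; rewrite mxE -[p]enum_valK; apply: h => z z0.
  rewrite -[RHS](hx z z0) (reindex (fun p : 'I_K => enum_val p)) /=.
    by apply: eq_bigr => q _; rewrite enum_valK.
  by exists enum_rank => ? _; rewrite ?enum_valK ?enum_rankK.
have freeM : row_free M.
  apply: inj_row_free => x xM; apply: e_free => z z0.
  rewrite (eq_bigr (fun p => \sum_j x 0 p * M p j * nth 0 L j z)); last first.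
    by move=> p _; rewrite hM // mulr_sumr; apply: eq_bigr => j _; rewrite mulrA.
  rewrite exchange_big big1 //= => j _; rewrite -mulr_suml.
  by move/rowP/(_ j): xM; rewrite !mxE => ->; rewrite mul0r.
have fullM : row_full M.
  rewrite /row_full eqn_leq rank_leq_col /=.
  by move: freeM; rewrite /row_free => /eqP ->; rewrite KE.
have [B BM] := row_fullP fullM.
have LB (j : 'I_(size L)) : nth 0 L j ~ (fun z => \sum_p B j p * e p z).
  move=> z z0; rewrite (eq_bigr (fun p => \sum_q B j p * M p q * nth 0 L q z)); last first.
    by move=> p _; rewrite hM // mulr_sumr; apply: eq_bigr => q _; rewrite mulrA.
  rewrite exchange_big /= (eq_bigr (fun q => (B *m M) j q * nth 0 L q z)); last first.
    by move=> q _; rewrite -mulr_suml mxE.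
  rewrite BM (bigD1 j) //= big1 => [|q qj]; first by rewrite mxE eqxx mul1r addr0.
  by rewrite mxE eq_sym (negbTE qj) mul0r.
split=> [c hc p pL|f [p pL ->]].
  pose y : 'rV[C R]_(size L) := \row_j c j.
  have yB : y *m B = 0.
    apply: e_free => z z0; rewrite -[RHS](hc z z0) /lin.
    rewrite (eq_bigr (fun p => \sum_(j < size L) c j * B j p * e p z)); last first.
      by move=> q _; rewrite mxE mulr_suml; apply: eq_bigr => j _; rewrite mxE.
    rewrite exchange_big; apply: eq_bigr => j _ /=; rewrite LB // mulr_sumr.
    by apply: eq_bigr => q _; rewrite -mulrA.
  have : y = 0 by rewrite -[y]mulmx1 -BM mulmxA yB mul0mx.
  by move/rowP/(_ (Ordinal pL)); rewrite !mxE.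
have pes (r : seq 'I_K) : pole_le N (fun z => \sum_(q <- r) B (Ordinal pL) q * e q z).
  elim: r => [|q r IH].
    apply: pole_le_off (pole_le_leq (leq0n N) (pole_le_cst 0)) _ => z _.
    by rewrite big_nil.
  apply: pole_le_off (pole_leD (pole_leZ (B (Ordinal pL) q) (pole_le_char _ N0)) IH) _.
  by move=> z _; rewrite big_cons.
by apply: pole_le_off (pes (index_enum _)) _; exact/eq_off_sym/(LB (Ordinal pL)).
Qed.

End Dimension.
End Spans.

(** * Linear relations between derivatives of minors, and the spanning families *)

Section MinorRelations.
Implicit Types (z : vec) (f g h : fn) (i j k l : 'I_3) (m : nat * nat * nat).

Lemma partialsZ (a : C R) m f : mero f ->
  partials m (fun z => a * f z) ~ (fun z => a * partials m f z).
Proof.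
have iterZ i n f' : mero f' -> iter n (pd i) (fun z => a * f' z)
    ~ (fun z => a * iter n (pd i) f' z).
  move=> mf; elim: n => //= n IH.
  apply: eq_off_trans (pd_off i IH) _.
  by apply: pd_offZ; exact: mero_iter.
move=> mf; rewrite !partialsE.
apply: eq_off_trans (iter_pd_off _ _ _) _; last first.
  by apply: (iterZ i1); do 2 apply: mero_iter.
apply: eq_off_trans (iter_pd_off _ _ _) _; last first.
  by apply: (iterZ i2); apply: mero_iter.
exact: iterZ.
Qed.

Lemma mero_minor2 i j k l : mero (minor2 i j k l).
Proof. exact: pole_le_mero (pole_le_minor2 i j k l). Qed.

Local Notation Z i j := (pd i (dlog j)).

Lemma minor2Z i j k l z : minor2 i j k l z = Z i k z * Z j l z - Z i l z * Z j k z.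
Proof. by rewrite minor2E !zetaE. Qed.

Lemma pd_minor2 a i j k l : pd a (minor2 i j k l) ~ (fun z =>
    pd a (Z i k) z * Z j l z + Z i k z * pd a (Z j l) z
  - (pd a (Z i l) z * Z j k z + Z i l z * pd a (Z j k) z)).
Proof.
have mz i' j' : mero (Z i' j') by exact/mero_pd/mero_dlog.
have E : minor2 i j k l = fun z => Z i k z * Z j l z - Z i l z * Z j k z.
  by apply: funext => z; exact: minor2Z.
rewrite E.
apply: eq_off_trans (pd_offB _ (meroM (mz _ _) (mz _ _)) (meroM (mz _ _) (mz _ _))) _.
move=> z z0; exact: (congr2 (fun x y => x - y)
  (pd_offM a (mz i k) (mz j l) z0) (pd_offM a (mz i l) (mz j k) z0)).
Qed.

(* The 2-form d(dlog k) /\ d(dlog l), with coefficients (12;kl), (13;kl), (23;kl), is closed. *)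
Lemma minor2_closed k l : pd i3 (minor2 i1 i2 k l)
  ~ (fun z => pd i2 (minor2 i1 i3 k l) z - pd i1 (minor2 i2 i3 k l) z).
Proof.
have ZC a i j : pd a (Z i j) ~ pd i (Z a j) by apply: pd_offC; exact: mero_dlog.
move=> z z0; apply: etrans (pd_minor2 i3 i1 i2 k l z0) _.
apply: etrans (esym (congr2 (fun x y => x - y)
  (pd_minor2 i2 i1 i3 k l z0) (pd_minor2 i1 i2 i3 k l z0))).
rewrite (ZC i3 i1 k z z0) (ZC i3 i1 l z z0) (ZC i3 i2 k z z0) (ZC i3 i2 l z z0).
rewrite (ZC i2 i1 k z z0) (ZC i2 i1 l z z0).
move: (Z i1 k z) (Z i1 l z) (Z i2 k z) (Z i2 l z) (Z i3 k z) (Z i3 l z).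
move: (pd i1 (Z i3 k) z) (pd i1 (Z i3 l) z) (pd i2 (Z i3 k) z) (pd i2 (Z i3 l) z).
move: (pd i1 (Z i2 k) z) (pd i1 (Z i2 l) z) => *.
by ring.
Qed.

Lemma minor2_sym i j k l : minor2 i j k l ~ minor2 k l i j.
Proof.
move=> z z0; rewrite !minor2Z; have ZC := pd_dlogC.
rewrite (ZC k i z z0) (ZC l j z z0) (ZC k j z z0) (ZC l i z z0).
by rewrite [Z i l z * _]mulrC.
Qed.

Local Ltac pair_ring :=
  repeat match goal with |- context [pd ?a (dlog ?b) ?z] =>
    generalize (pd a (dlog b) z); intro end; ring.

(** Antisymmetry in the row indices: every pair is one of the three increasing ones up to a factor
    1, -1 or 0. *)
Lemma minor2_pair i j : exists (s : C R) (p : 'I_3 * 'I_3),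
  p \in [:: (i1, i2); (i1, i3); (i2, i3)] /\
  forall k l z, minor2 i j k l z = s * minor2 p.1 p.2 k l z.
Proof.
move: i j; apply: ord3_ind; apply: ord3_ind.
- exists 0, (i1, i2); split=> // k l z; rewrite !minor2Z /=; pair_ring.
- exists 1, (i1, i2); split=> // k l z; rewrite !minor2Z /=; pair_ring.
- exists 1, (i1, i3); split=> // k l z; rewrite !minor2Z /=; pair_ring.
- exists (-1), (i1, i2); split=> // k l z; rewrite !minor2Z /=; pair_ring.
- exists 0, (i1, i2); split=> // k l z; rewrite !minor2Z /=; pair_ring.
- exists 1, (i2, i3); split=> // k l z; rewrite !minor2Z /=; pair_ring.
- exists (-1), (i1, i3); split=> // k l z; rewrite !minor2Z /=; pair_ring.
- exists (-1), (i2, i3); split=> // k l z; rewrite !minor2Z /=; pair_ring.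
- exists 0, (i1, i2); split=> // k l z; rewrite !minor2Z /=; pair_ring.
Qed.

Section Families.
Variable v : fn.

(** Degree 1 contributes nothing, in accordance with A_1 = A_0. *)
Fixpoint families (n : nat) : seq fn :=
  if n is n'.+1 then families n' ++ (if n' is _.+1 then gr_family tau v n else [::])
  else [:: fun=> 1].

Lemma size_families n : (size (families n.+1) <= n.+1 ^ 3)%N.
Proof.
elim: n => // n IH; rewrite [families n.+2]/(families n.+1 ++ gr_family tau v n.+2).
rewrite size_cat; apply: leq_trans (leq_add IH (size_gr_family tau v n)) _.
by rewrite subnKC // leq_exp2r.
Qed.

Lemma listed_families d n f : (2 <= d <= n)%N -> listed (gr_family tau v d) f ->
  listed (families n) f.
Proof.
elim: n => [|[|n] IH]; [by move=> /andP[]; lia | by move=> /andP[]; lia |].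
move=> /andP[d2 dn] hf; rewrite [families n.+2]/(families n.+1 ++ gr_family tau v n.+2).
apply/listed_cat; move: dn; rewrite leq_eqVlt => /predU1P[<-|dn]; first by right.
by left; apply: IH => //; rewrite d2.
Qed.

Lemma listed_families1 n : listed (families n) (fun=> 1).
Proof. by elim: n => [|n IH]; [exists 0%N | apply/listed_cat; left]. Qed.

Lemma listed_gr_family n f : listed (gr_family tau v n) f <->
  (exists2 m, m \in exps3 n 0 & f = partials_logtheta tau m) \/
  (exists2 m, m \in exps3 n 2 & f = partials m v) \/
  (exists2 m, m \in exps2 n 3 & f = partials m (minor2 i1 i2 i1 i2)) \/
  (exists2 m, m \in exps2 n 3 & f = partials m (minor2 i1 i2 i1 i3)) \/
  (exists2 m, m \in exps2 n 3 & f = partials m (minor2 i1 i2 i2 i3)) \/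
  (exists2 m, m \in exps3 n 3 & f = partials m (minor2 i1 i3 i1 i3)) \/
  (exists2 m, m \in exps3 n 3 & f = partials m (minor2 i1 i3 i2 i3)) \/
  (exists2 m, m \in exps3 n 3 & f = partials m (minor2 i2 i3 i2 i3)) \/
  (exists2 m, m \in exps3 n 4 & f = partials m minor3).
Proof.
exact: (listed_cat_map9 (0 : fn) (@partials_logtheta R tau)
  (fun m => partials m v) (fun m => partials m (minor2 i1 i2 i1 i2))
  (fun m => partials m (minor2 i1 i2 i1 i3)) (fun m => partials m (minor2 i1 i2 i2 i3))
  (fun m => partials m (minor2 i1 i3 i1 i3)) (fun m => partials m (minor2 i1 i3 i2 i3))
  (fun m => partials m (minor2 i2 i3 i2 i3)) (fun m => partials m minor3)
  (exps3 n 0) (exps3 n 2) (exps2 n 3) (exps2 n 3) (exps2 n 3)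
  (exps3 n 3) (exps3 n 3) (exps3 n 3) (exps3 n 4)).
Qed.

(** Deliberately redundant: all minors with all derivatives are allowed, so that derivations
    preserve the class, which [gr_family] does not make evident. The bound in [gen_log] excludes the
    non-periodic first derivatives of log theta. *)
Inductive gens (d : nat) : fn -> Prop :=
| gen_one : d = 0%N -> gens d (fun=> 1)
| gen_log m : (2 <= weight m)%N -> weight m = d -> gens d (partials_logtheta tau m)
| gen_v m : (weight m + 2)%N = d -> gens d (partials m v)
| gen_minor2 m i j k l : (weight m + 3)%N = d -> gens d (partials m (minor2 i j k l))
| gen_minor3 m : (weight m + 4)%N = d -> gens d (partials m minor3).

Definition gens_le (n : nat) f := exists2 d, (d <= n)%N & gens d f.

(** Closedness of the 2-forms trades a derivative in z_3 of (12;kl) for derivatives of (13;kl) and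
    (23;kl). For kl = 13 and 23 these are in the family directly or by symmetry; for kl = 12
    symmetry turns them into (12;13) and (12;23), which are treated before. *)
Lemma span_partials_minor2 n m i j k l : (weight m + 3 <= n)%N ->
  span (listed (families n)) (partials m (minor2 i j k l)).
Proof.
move=> mn; set S := listed (families n).
have mM := mero_minor2.
have fam f d : (2 <= d <= n)%N -> listed (gr_family tau v d) f -> span S f.
  by move=> dn hf; apply: span_mem; exact: listed_families hf.
have dn m' : weight m' = weight m -> (2 <= weight m' + 3 <= n)%N by move=> ->; lia.
have c1 m' : weight m' = weight m -> span S (partials m' (minor2 i1 i3 i1 i3)).
  move=> w; apply: (fam _ _ (dn _ w)); apply/listed_gr_family; do 5 right; left.
  by exists m'; rewrite ?mem_exps3.
have c2 m' : weight m' = weight m -> span S (partials m' (minor2 i1 i3 i2 i3)).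
  move=> w; apply: (fam _ _ (dn _ w)); apply/listed_gr_family; do 6 right; left.
  by exists m'; rewrite ?mem_exps3.
have c3 m' : weight m' = weight m -> span S (partials m' (minor2 i2 i3 i2 i3)).
  move=> w; apply: (fam _ _ (dn _ w)); apply/listed_gr_family; do 7 right; left.
  by exists m'; rewrite ?mem_exps3.
(* One application of the relation suffices even for a high power of the third derivation, since the
   two minors replacing (12;kl) are assumed under control for all exponents. *)
have red k' l' :
  (forall a b, weight (a, b, 0%N) = weight m ->
    span S (partials (a, b, 0%N) (minor2 i1 i2 k' l'))) ->
  (forall m', weight m' = weight m -> span S (partials m' (minor2 i1 i3 k' l'))) ->
  (forall m', weight m' = weight m -> span S (partials m' (minor2 i2 i3 k' l'))) ->
  forall m', weight m' = weight m -> span S (partials m' (minor2 i1 i2 k' l')).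
  move=> h0 h1 h2 [[a b] [|c]] w; first exact: h0.
  have w1 : weight (a, b.+1, c) = weight m by move: w; rewrite /weight /=; lia.
  have w2 : weight (a.+1, b, c) = weight m by move: w; rewrite /weight /=; lia.
  apply: span_off (spanB (h1 _ w1) (h2 _ w2)) _.
  rewrite -incr3 -incr2 -incr1.
  apply: eq_off_trans (partials_incr i3 (a, b, c) (mM _ _ _ _)).
  apply: eq_off_trans (eq_off_sym (partials_off _ (minor2_closed _ _))).
  apply: eq_off_trans (eq_off_sym (partialsB _ (mero_pd _ (mM _ _ _ _)) (mero_pd _ (mM _ _ _ _)))).
  move=> z z0; exact: (congr2 (fun x y => x - y)
    (esym (partials_incr i2 (a, b, c) (mM i1 i3 k' l') z0))
    (esym (partials_incr i1 (a, b, c) (mM i2 i3 k' l') z0))).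
have swap m' i' j' k' l' : span S (partials m' (minor2 i' j' k' l')) ->
    span S (partials m' (minor2 k' l' i' j')).
  by move=> h; apply: span_off h _; apply: partials_off; exact: minor2_sym.
have c4 : forall m', weight m' = weight m -> span S (partials m' (minor2 i1 i2 i1 i3)).
  apply: red; [move=> a b w | exact: c1 | by move=> m' w; exact: (swap _ _ _ _ _ (c2 _ w))].
  apply: (fam _ _ (dn _ w)); apply/listed_gr_family; do 3 right; left.
  by exists (a, b, 0%N) => //; rewrite mem_exps2 w eqxx.
have c5 : forall m', weight m' = weight m -> span S (partials m' (minor2 i1 i2 i2 i3)).
  apply: red; [move=> a b w | exact: c2 | exact: c3].
  apply: (fam _ _ (dn _ w)); apply/listed_gr_family; do 4 right; left.
  by exists (a, b, 0%N) => //; rewrite mem_exps2 w eqxx.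
have c6 : forall m', weight m' = weight m -> span S (partials m' (minor2 i1 i2 i1 i2)).
  apply: red; [move=> a b w | move=> m' w; exact: (swap _ _ _ _ _ (c4 _ w))
    | move=> m' w; exact: (swap _ _ _ _ _ (c5 _ w))].
  apply: (fam _ _ (dn _ w)); apply/listed_gr_family; do 2 right; left.
  by exists (a, b, 0%N) => //; rewrite mem_exps2 w eqxx.
have [s [p [pin E1]]] := minor2_pair i j; have [t [q [qin E2]]] := minor2_pair k l.
have : span S (partials m (minor2 p.1 p.2 q.1 q.2)).
  move: pin qin; rewrite !inE => /or3P[]/eqP-> /or3P[]/eqP->.
  - exact: (c6 _ erefl).
  - exact: (c4 _ erefl).
  - exact: (c5 _ erefl).
  - exact: (swap _ _ _ _ _ (c4 _ erefl)).
  - exact: (c1 _ erefl).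
  - exact: (c2 _ erefl).
  - exact: (swap _ _ _ _ _ (c5 _ erefl)).
  - exact: (swap _ _ _ _ _ (c2 _ erefl)).
  - exact: (c3 _ erefl).
move=> /(spanZ (s * t)) h; apply: span_off h _.
apply: eq_off_trans (eq_off_sym (partialsZ (s * t) m (mM _ _ _ _))) _.
apply: partials_off => z z0; rewrite E1 (minor2_sym _ _ k l z0) E2.
by rewrite (minor2_sym q.1 _ _ _ z0) mulrA.
Qed.

Lemma gens_families n f : gens_le n f -> span (listed (families n)) f.
Proof.
move=> [d dn]; have fam d' g : (2 <= d' <= n)%N -> listed (gr_family tau v d') g ->
    span (listed (families n)) g.
  by move=> dn' hg; apply: span_mem; exact: listed_families hg.
case=> [_|m m2 md|m md|m i j k l md|m md].
- exact/span_mem/listed_families1.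
- apply: (fam d); first by lia.
  by apply/listed_gr_family; left; exists m; rewrite ?mem_exps3 // addn0 md.
- apply: (fam d); first by lia.
  by apply/listed_gr_family; right; left; exists m; rewrite ?mem_exps3 // md.
- by apply: span_partials_minor2; rewrite md.
- apply: (fam d); first by lia.
  by apply/listed_gr_family; do 8 right; exists m; rewrite ?mem_exps3 // md.
Qed.

Lemma pole_le_family n f : pole_le 2 v -> (2 <= n)%N -> listed (gr_family tau v n) f ->
  pole_le n f.
Proof.
have aux p m d g : pole_le d g -> (weight m + d == n)%N -> p = partials m g -> pole_le n p.
  by move=> pg /eqP <- ->; exact: pole_le_partials.
move=> pv n2 /listed_gr_family[[m mE ->]|].
  rewrite mem_exps3 addn0 in mE; rewrite -(eqP mE).
  by apply: pole_le_logtheta; rewrite (eqP mE).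
have auxm p m i j k l : (weight m + 3 == n)%N -> p = partials m (minor2 i j k l) -> pole_le n p.
  by apply: aux; exact: pole_le_minor2.
case=> [[m]|]; first by rewrite mem_exps3; apply: aux.
case=> [[m]|]; first by rewrite mem_exps2 => /andP[_]; exact: auxm.
case=> [[m]|]; first by rewrite mem_exps2 => /andP[_]; exact: auxm.
case=> [[m]|]; first by rewrite mem_exps2 => /andP[_]; exact: auxm.
case=> [[m]|]; first by rewrite mem_exps3; exact: auxm.
case=> [[m]|]; first by rewrite mem_exps3; exact: auxm.
case=> [[m]|]; first by rewrite mem_exps3; exact: auxm.
by case=> m; rewrite mem_exps3; apply: aux; exact: pole_le_minor3.
Qed.

Lemma pole_le_families n f : pole_le 2 v -> listed (families n) f -> pole_le n f.
Proof.
move=> pv; elim: n => [|n IH].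
  by move=> [[|k] // _ ->]; exact: pole_le_cst.
move=> /listed_cat[/IH|]; first exact: pole_le_leq.
by case: n {IH} => [|n]; [case | exact: pole_le_family].
Qed.

Lemma gens_mero n f : mero v -> gens_le n f -> mero f.
Proof.
move=> mv [d _] [_|m m2 _|m _|m i j k l _|m _].
- exact: mero_cst.
- by apply: mero_logtheta; lia.
- exact: mero_partials.
- exact/mero_partials/mero_minor2.
- exact/mero_partials/(pole_le_mero pole_le_minor3).
Qed.

Lemma gens_pd n i f : mero v -> gens_le n f -> span (gens_le n.+1) (pd i f).
Proof.
move=> mv [d dn] [_|m m2 md|m md|m a b k l md|m md].
- by apply: span_off (span0 _) _ => z _; rewrite pd_cst.
- apply: span_off (span_mem (_ : gens_le n.+1 (partials_logtheta tau (incr i m)))) _.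
    by exists d.+1 => //; apply: gen_log; rewrite weight_incr ?md //; lia.
  by apply/eq_off_sym/pd_logtheta; lia.
- apply: span_off (span_mem (_ : gens_le n.+1 (partials (incr i m) v))) _.
    by exists d.+1 => //; apply: gen_v; rewrite weight_incr -md.
  exact/eq_off_sym/pd_partials.
- apply: span_off (span_mem (_ : gens_le n.+1 (partials (incr i m) (minor2 a b k l)))) _.
    by exists d.+1 => //; apply: gen_minor2; rewrite weight_incr -md.
  exact/eq_off_sym/pd_partials/mero_minor2.
- apply: span_off (span_mem (_ : gens_le n.+1 (partials (incr i m) minor3))) _.
    by exists d.+1 => //; apply: gen_minor3; rewrite weight_incr -md.
  exact/eq_off_sym/pd_partials/(pole_le_mero pole_le_minor3).
Qed.

(** This is what allows the induction to reach degree 2 before anything is known about derivatives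
    of v. *)
Lemma gens_le1 n f : (n <= 1)%N -> gens_le n f -> f = fun=> 1.
Proof. by move=> n1 [d dn] [] // *; lia. Qed.

End Families.
End MinorRelations.

(** * From the decomposition of H^3 to bases of the graded pieces *)

Section GradedSpan.
Implicit Types (z : vec) (f g h : fn) (i : 'I_3).

Lemma A_N1 f : A tau (0%:Z - 1) f <-> f ~ (fun=> 0).
Proof. by []. Qed.

Lemma A_predS (n : nat) : A tau (n.+1%:Z - 1) = A tau n%:Z.
Proof. by rewrite (_ : n.+1%:Z - 1 = n%:Z) //; lia. Qed.

Lemma pole_le_A_pred n f : pole_le n f -> A tau (n.+1%:Z - 1) f.
Proof. by move=> pf; rewrite A_predS; exact: pole_le_A. Qed.

Lemma A0 (n : nat) : A tau (n%:Z - 1) (0 : fn).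
Proof.
case: n => [|n]; first exact/A_N1.
by apply: pole_le_A_pred; apply: pole_le_leq (pole_le_cst 0).
Qed.

Lemma grA_homog (n : nat) f : A tau n%:Z f -> grA tau (homog n f).
Proof.
move=> Af; split=> [p|].
  rewrite /homog; case: eqP => [->//|_]; rewrite -A_predS; exact: A0.
by exists n.+1 => p np; rewrite /homog gtn_eqF //; exact: A0.
Qed.

Lemma sum_scale_eval (p : nat) (c : 'I_p -> C R) (s : 'I_p -> nat -> fn) n z :
  (\sum_(k < p) c k *: s k) n z = \sum_(k < p) c k * s k n z.
Proof. by rewrite !fct_sumE. Qed.

Lemma span_big S (p : nat) (c : 'I_p -> C R) (s : 'I_p -> fn) :
  (forall k, span S (s k)) -> span S (fun z => \sum_(k < p) c k * s k z).
Proof.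
move=> hs; have : forall r : seq 'I_p, span S (fun z => \sum_(k <- r) c k * s k z).
  elim=> [|k r IH].
    by apply: span_off (span0 _) _ => z _; rewrite big_nil.
  by apply: span_off (spanD (spanZ (c k) (hs k)) IH) _ => z _; rewrite big_cons.
exact.
Qed.

Lemma linear_span_comp S (G : set (nat -> fn)) n :
  (forall a, G a -> span S (a n)) ->
  forall w, linear_span G w -> span S (w n).
Proof.
move=> hG w [p [c [s [hs ->]]]].
by apply: span_off (span_big c (fun k => hG _ (hs k))) _ => z _; rewrite sum_scale_eval.
Qed.

Section WithV.
Variable v : fn.
Hypothesis v_compl : complements_W3 tau v.
Local Notation gens_le := (gens_le v).
Local Notation families := (families v).

Lemma span_homog S (d n : nat) f : (n = d -> span S f) -> span S (homog d f n).
Proof. by rewrite /homog; case: eqP => [-> h|_ _]; [exact: h | exact: span0]. Qed.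

Lemma W3_span n w : W3 tau w -> span (gens_le n) (w n).
Proof.
apply: linear_span_comp => a [[[->|[i [j ->]]]|[i [j [k [l ->]]]]]|->];
  apply: span_homog => nE.
- by apply: span_mem; exists 0%N => //; exact: gen_one.
- have [m w2 e] := zeta_logtheta i j.
  apply: span_off (span_mem _) (eq_off_sym e).
  by exists 2%N; rewrite ?nE //; apply: gen_log; rewrite w2.
- apply: span_mem; exists 3%N; first by rewrite nE.
  exact: (@gen_minor2 _ _ (0, 0, 0)%N).
- apply: span_mem; exists 4%N; first by rewrite nE.
  exact: (@gen_minor3 _ _ (0, 0, 0)%N).
Qed.

Lemma v_span n u : linear_span [set homog 2 v] u -> span (gens_le n) (u n).
Proof.
apply: linear_span_comp => a ->; apply: span_homog => nE.
by apply: span_mem; exists 2%N; [rewrite nE | exact: (@gen_v _ _ (0, 0, 0)%N)].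
Qed.

(* An element of [A n] is, modulo [A (n - 1)], a combination of the generators of
   degree n and of derivatives of elements of [A (n - 1)]; the latter are already
   known to be combinations of elements of S. *)
Lemma A_step S (n : nat) : (forall g, S g -> mero g) ->
  (forall i g, S g -> span (gens_le n) (pd i g)) ->
  (forall g, S g -> span (gens_le n) g) ->
  (forall f, A tau (n%:Z - 1) f -> span S f) ->
  forall f, A tau n%:Z f -> span (gens_le n) f.
Proof.
move=> mS dS gS hS f Af; have [spanning _] := v_compl.
have [w [u [Ww Uu [a12 [a13 [a23 [g12 g13 g23 h]]]]]]] := spanning _ (grA_homog Af).
(* Equality in gr A is used in degree n only: there f differs from w + u plus an exact term by an
   element of A (n - 1), which S spans. *)
have {}h := hS _ (h n).
have dspan i a : grA tau a -> span (gens_le n) (gpartial i a n).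
  move=> [ga _]; case: n mS dS gS hS {Af h} => [|n] mS dS gS hS; first exact: span0.
  rewrite /gpartial -[partial i _]/(@partial R i (a n)) -pdE.
  by apply: (span_pd mS (dS i)); apply: hS; rewrite A_predS; exact: ga.
have rest := spanD (spanD (W3_span n Ww) (v_span n Uu))
  (spanD (spanB (dspan i1 _ g23) (dspan i2 _ g13)) (dspan i3 _ g12)).
apply: span_off (spanD (span_sub gS h) rest) _ => z z0.
have fE : f z = homog n f n z by rewrite /homog eqxx.
have cancel (x y t : C R) : x - y - t + (y + t) = x by ring.
rewrite fE; exact: cancel.
Qed.

(** Passing to degree n differentiates the generators of degree at most n - 1. Those involving v
    occur among them only for n > 2, whence the condition on [mero v]. *)
Lemma A_span n : ((2 < n)%N -> mero v) ->
  forall f, A tau n%:Z f -> span (gens_le n) f.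
Proof.
elim: n => [|n IH] mv.
  (* In degree 0 there is nothing below: A (-1) consists of the functions vanishing off Theta,
     spanned by the empty set. *)
  apply: (@A_step (fun=> False)) => // f /A_N1 f0.
  by apply: span_off (span0 _) _; exact: eq_off_sym.
have {}IH := IH (fun n2 => mv (leqW n2)).
apply: (@A_step (gens_le n)).
- move=> g; have [n1|n1] := leqP n 1; last exact: gens_mero (mv n1).
  by move=> /(gens_le1 n1) ->; exact: mero_cst.
- move=> i g; have [n1|n1] := leqP n 1; last exact: gens_pd (mv n1).
  move=> /(gens_le1 n1) ->; apply: span_off (span0 _) _ => z _.
  by rewrite pd_cst.
- by move=> g [d dn hd]; apply: span_mem; exists d => //; exact: leqW.
- by move=> f; rewrite A_predS; exact: IH.
Qed.

Lemma families_char n : ((2 < n)%N -> mero v) -> (0 < n)%N ->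
  free_off (families n) /\ forall f, listed (families n) f -> pole_le n f.
Proof.
move=> mv n0; apply: spanning_list => //.
  by case: n n0 {mv} => // n _; exact: size_families.
move=> chi; apply: (span_sub (@gens_families v n)).
by apply: A_span => //; apply: pole_le_A; exact: pole_le_char.
Qed.

(** At n = 2 the condition in [families_char] is vacuous, and v itself, with exponents (0, 0, 0), is
    listed in [families 2]. From here on v may be differentiated. *)
Lemma pole_le_v : pole_le 2 v.
Proof.
have [//|_ h] := @families_char 2 _ isT; apply: h.
apply: (@listed_families v 2) => //; apply/listed_gr_family; right; left.
by exists (0, 0, 0)%N.
Qed.

Lemma sum_fam_eval (s : seq fn) (c : nat -> C R) z :
  (\sum_(k < size s) c k *: s`_k) z = lin s c z.
Proof. by rewrite fct_sumE. Qed.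

Lemma gr_family_basis n : (2 <= n)%N -> gr_basis tau n (gr_family tau v n).
Proof.
case: n => [|[|n]] // _; set F := gr_family tau v n.+2; set L := families n.+1.
have mv : mero v := pole_le_mero pole_le_v.
have famE : families n.+2 = L ++ F by [].
have [freeLF _] := families_char (fun=> mv) (isT : (0 < n.+2)%N).
have poleL f : listed L f -> pole_le n.+1 f by apply: pole_le_families; exact: pole_le_v.
have predE : n.+2%:Z - 1 = n.+1%:Z by lia.
split.
- move=> k kF; apply: pole_le_A; apply: (pole_le_family pole_le_v) => //.
  exact: listed_nth.
- rewrite predE => c /(A_span (fun=> mv)) /(span_sub (@gens_families v n.+1)).
  move=> /span_lin[d hd] k kF.
  (* If the combination of F with coefficients c lies one step lower in the filtration, it equals a
     combination of L with coefficients d; then -d on L and c on F form a relation on [L ++ F]. *)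
  have := freeLF (fun p => if (p < size L)%N then - d p else c (p - size L)%N) _ (size L + k)%N.
  rewrite famE size_cat ltn_add2l [(_ + k < size L)%N]ltnNge leq_addr /= addKn.
  apply=> // z z0.
  rewrite lin_cat; have := hd z z0; rewrite sum_fam_eval => hz.
  rewrite (_ : lin F _ z = lin F c z); last first.
    by apply: eq_bigr => p _; rewrite ltnNge leq_addr /= addKn.
  rewrite hz -[RHS](addNr (lin L d z)); congr (_ + _).
  by rewrite /lin -sumrN; apply: eq_bigr => p _; rewrite ltn_ord mulNr.
- move=> f /(A_span (fun=> mv)) /(span_sub (@gens_families v n.+2)) /span_lin[c hc].
  (* Only the coefficients on F are kept: the part over L has pole order at most n + 1 and vanishes
     in the graded piece of degree n + 2. *)
  exists (fun k => c (size L + k)%N); rewrite predE; apply: pole_le_A.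
  apply: pole_le_off (span_pole_le poleL (lin_span L c)) _ => z z0.
  have := hc z z0; rewrite famE lin_cat => e.
  rewrite -[(f - _) z]/(f z - (\sum_(k < size F) c (size L + k)%N *: F`_k) z).
  by rewrite (sum_fam_eval F (fun k => c (size L + k)%N)) e addrK.
Qed.

End WithV.
End GradedSpan.

End NonsingularTheta.

Theorem mainTheorem4 (R : realType) (tau : 'M[C R]_3)
  (tau_siegel : siegel tau) (Theta_ns : theta_nonsingular tau)
  (v : 'cV[C R]_3 -> C R) (v_A2 : A tau 2%:Z v)
  (v_compl : complements_W3 tau v) (n : nat) (n_ge2 : (2 <= n)%N) :
  gr_basis tau n (gr_family tau v n).
Proof. exact: gr_family_basis. Qed.
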